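(* Let $S=(S,\le)$ be a partially ordered Polish space in which a subset is compact if and only if it is closed and order bounded, and consider the piecewise deterministic Markov process (PDMP) on $S$ with continuous semi-flow $\Phi:S\times\mathbb R_+\to S$, jump intensity $\lambda\in(0,\infty)$, Polish jump shock space $U$, shock distribution $\mu$ on $U$, and measurable jump function $F:S\times U\to S$. Suppose that: (a) for all $t\ge0$, $x\mapsto\Phi(x,t)$ is order preserving on $S$, and for all $u\in U$, $x\mapsto F(x,u)$ is order preserving on $S$; (b) there exist measurable functions $f_1,f_2:U\to S$ such that, with $\xi,\xi'$ independent draws from $\mu$, $f_1(\xi)\le F(x,\xi)\le f_2(\xi)$ for all $x\in S$ and $\mathbb P\{f_2(\xi)\le f_1(\xi')\}>0$. Then the PDMP is globally stable: it has a unique stationary distribution $\phi^*$ and $$\lim_{t\to\infty}\beta(\phi P_t,\phi^* )=0\quad\text{for all }\phi\in\mathcal P(S).$$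
   Context: A partially ordered Polish space is a separable, completely metrizable topological space $S$ with a closed partial order $\le$ (that is, $x_i\le y_i$, $x_i\to x$, $y_i\to y$ imply $x\le y$). A subset is order bounded if it is contained in some order interval $[a,b]=\{x:a\le x\le b\}$ with $a\le b$. A map $G:S\to S$ is order preserving if $x\le y$ implies $G(x)\le G(y)$. $\mathcal P(S)$ is the set of Borel probability measures on $S$, $ibS$ the set of bounded Borel measurable increasing functions on $S$, $\phi(h)=\int h\,d\phi$, and $\beta(\phi,\psi)=\sup\{|\phi(h)-\psi(h)|:h\in ibS,\ |h|\le1\}$. A semi-flow satisfies $\Phi(x,0)=x$ and $\Phi(\Phi(x,s),t)=\Phi(x,s+t)$ for all $x\in S$, $s,t\ge0$. The PDMP $(X_t)_{t\ge0}$ is constructed from independent elements: $X_0$ with values in $S$, an iid sequence $(E_n)_{n\ge1}$ with distribution $\mathrm{Exp}(\lambda)$ (rate $\lambda$), and an iid sequence $(\xi_n)_{n\ge1}$ with distribution $\mu$. Put $Z_0=X_0$, $Z_{n+1}=F(\Phi(Z_n,E_{n+1}),\xi_{n+1})$, $T_0=0$, $T_n=\sum_{i=1}^nE_i$, $N_t=\max\{n\ge0:T_n\le t\}$, and $X_t=\Phi(Z_{N_t},t-T_{N_t})$. Its transition probability function is $P_t(x,B)=\mathbb P\{X_t\in B\mid X_0=x\}$, and $(\phi P_t)(B)=\int P_t(x,B)\phi(dx)$. A stationary distribution is a $\phi^*\in\mathcal P(S)$ with $\phi^*P_t=\phi^*$ for all $t\ge0$. *)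

(* Defs.v *)
From HB Require Import structures.
From mathcomp Require Import all_boot all_order all_algebra.
From mathcomp Require Import all_classical all_reals all_analysis.

Set Implicit Arguments.
Unset Strict Implicit.
Unset Printing Implicit Defensive.

Import Order.TTheory GRing.Theory Num.Theory.
Import numFieldNormedType.Exports.

Local Open Scope classical_set_scope.
Local Open Scope ring_scope.

Notation borel T := (g_sigma_algebraType (@open T)).

Section PolishSpaces.
Context (R : realType) (T : topologicalType).

Definition separable := exists2 D : set T, countable D & dense D.

Definition metric (d : T -> T -> R) :=
  [/\ forall x y, 0 <= d x y,
      forall x y, d x y = 0 <-> x = y,
      forall x y, d x y = d y x &
      forall x y z, d x z <= d x y + d y z].

Definition induces_topology (d : T -> T -> R) := forall x : T,
  nbhs x = filter_from [set e : R | 0 < e] (fun e => [set y | d x y < e]).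

Definition complete_metric (d : T -> T -> R) := forall u : nat -> T,
  (forall e : R, 0 < e -> exists N, forall m n,
     (N <= m)%N -> (N <= n)%N -> d (u m) (u n) < e) ->
  exists l : T, u @ \oo --> l.

Definition completely_metrizable := exists d : T -> T -> R,
  [/\ metric d, induces_topology d & complete_metric d].

Definition polish := separable /\ completely_metrizable.

End PolishSpaces.

Section OrderedSpaces.
Context (disp : Order.disp_t) (S : POrderedPointedTopological.type disp).

Definition closed_order := forall (x y : nat -> S) (a b : S),
  (forall i, (x i <= y i)%O) -> x @ \oo --> a -> y @ \oo --> b -> (a <= b)%O.

Definition order_interval (a b : S) : set S := [set x | (a <= x <= b)%O].

Definition order_bounded (A : set S) :=
  exists a b : S, (a <= b)%O /\ A `<=` order_interval a b.

Definition order_preserving (G : S -> S) :=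
  forall x y : S, (x <= y)%O -> (G x <= G y)%O.

Definition ibS (R : realType) : set (borel S -> R) := [set h : borel S -> R |
  [/\ measurable_fun [set: borel S] (h : borel S -> R),
      exists M : R, forall x, `|h x| <= M &
      forall x y : S, (x <= y)%O -> h x <= h y]].

(* The library's integral only needs a set function, and depends only on its
   values on measurable sets. This lets [phi P_t], given by its formula in
   [evolve], be used without packaging it as a probability measure. *)
Definition beta (R : realType) (phi psi : set (borel S) -> \bar R) : \bar R :=
  ereal_sup [set `|\int[phi]_x (h x)%:E - \int[psi]_x (h x)%:E|%E | h in
    [set h : borel S -> R | ibS h /\ forall x, `|h x| <= 1]].

End OrderedSpaces.

Arguments ibS {disp} S R.

(* Families of set systems satisfying the product rule on every finite
   subfamily. Random elements are independent when the sigma-algebras they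
   generate are. *)
Definition mutually_independent d (T : measurableType d) (R : realType)
    (P : probability T R) (I : choiceType) (G : I -> set (set T)) :=
  forall (J : seq I) (A : I -> set T), uniq J ->
    (forall i, i \in J -> G i (A i)) ->
    P (\bigcap_(i in [set` J]) A i) = (\prod_(i <- J) P (A i))%E.

Section PDMP.
Context (R : realType) (S U : ptopologicalType).

(* Only the values of [Phi x t] at [0 <= t] are meaningful. *)
Definition semiflow (Phi : S -> R -> S) :=
  (forall x, Phi x 0 = x) /\
  (forall x s t, 0 <= s -> 0 <= t -> Phi (Phi x s) t = Phi x (s + t)).

Definition continuous_semiflow (Phi : S -> R -> S) :=
  semiflow Phi /\
  {within [set z : S * R | 0 <= z.2], continuous (fun z => Phi z.1 z.2)}.

Section Paths.
Variables (Phi : S -> R -> S) (F : S -> U -> S).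

(* Waiting times and shocks are numbered from 0: [e n] and [v n] stand for
   E_(n+1) and xi_(n+1). *)
Variables (x : S) (e : nat -> R) (v : nat -> U).

Fixpoint embedded_chain (n : nat) : S :=
  if n is m.+1 then F (Phi (embedded_chain m) (e m)) (v m) else x.

Definition jump_time (n : nat) : R := \sum_(i < n) e i.

(* The largest n with T_n <= t, and 0 on the null event where there is none. *)
Definition jump_count (t : R) : nat :=
  xget 0%N [set n | jump_time n <= t /\
                    forall m, jump_time m <= t -> (m <= n)%N].

Definition pdmp (t : R) : S :=
  Phi (embedded_chain (jump_count t)) (t - jump_time (jump_count t)).

End Paths.

Section Noise.
Context d (Omega : measurableType d) (P : probability Omega R).
Variables (E : nat -> {RV P >-> R}) (xi : nat -> {RV P >-> borel U}).

Definition noise_sigma_algebra (i : nat + nat) : set (set Omega) :=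
  match i with
  | inl n => preimage_set_system [set: Omega] (E n) measurable
  | inr n => preimage_set_system [set: Omega] (xi n) measurable
  end.

(* Waiting times are R_+-valued everywhere, not just almost surely, since they
   are fed to a semi-flow whose values at negative times are arbitrary. *)
Definition pdmp_noise (lambda : R) (mu : probability (borel U) R) :=
  [/\ forall n w, 0 <= E n w,
      forall n A, measurable A ->
        distribution P (E n) A = exponential_prob lambda A,
      forall n A, measurable A -> distribution P (xi n) A = mu A &
      mutually_independent P noise_sigma_algebra].

(* P{X_t \in B | X_0 = x}: as X_0 is independent of the noise, conditioning on
   X_0 = x amounts to starting the path at x. *)
Definition pdmp_transition (Phi : S -> R -> S) (F : S -> U -> S)
    (t : R) (x : borel S) (B : set (borel S)) : \bar R :=
  P [set w | B (pdmp Phi F x (E ^~ w) (xi ^~ w) t)].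

End Noise.

End PDMP.

Section Stability.
Context (R : realType) (disp : Order.disp_t)
  (S : POrderedPointedTopological.type disp).
Variable Pt : R -> borel S -> set (borel S) -> \bar R.

Definition evolve (phi : set (borel S) -> \bar R) (t : R)
    (B : set (borel S)) : \bar R :=
  \int[phi]_x Pt t x B.

Definition stationary (phi : probability (borel S) R) :=
  forall t, 0 <= t -> forall B, measurable B -> evolve phi t B = phi B.

Definition globally_stable := exists phi_star : probability (borel S) R,
  [/\ stationary phi_star,
      forall psi, stationary psi -> forall B, measurable B ->
        psi B = phi_star B &
      forall phi : probability (borel S) R,
        beta (evolve phi t) phi_star @[t --> +oo] --> 0%E].

End Stability.

(* Main.v *)
Require Import Defs.
From HB Require Import structures.
From mathcomp Require Import all_boot all_order all_algebra.
From mathcomp Require Import all_classical all_reals all_analysis.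
From mathcomp Require Import measurable_realfun lra ring finmap.

Set Implicit Arguments.
Unset Strict Implicit.
Unset Printing Implicit Defensive.

Import Order.TTheory GRing.Theory Num.Theory.
Import numFieldNormedType.Exports.

Local Open Scope classical_set_scope.
Local Open Scope ring_scope.

(** Write [p] for a positive lower bound, below [1], of the probability that a
    shock [u] and an independent shock [v] satisfy [f2 u <= f1 v]. On that event
    [F x u <= f2 u <= f1 v <= F y v] for all states [x] and [y]: a jump puts the
    process started from [x] below the one started from [y], however they were
    ordered before. So, for an increasing test function, averaging over a shock
    multiplies the oscillation by at most [1 - p] ([shock_avg_contraction]),
    and the flow, being monotone, maps increasing test functions to increasing
    ones without enlarging their oscillation. For increasing test functions two
    initial laws therefore merge with probability [p] at each jump, that is at
    rate [lambda * p], and their averages at time [t] differ by at most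
    [exp (- lambda p t)] ([time_avg_contraction]).

    That heuristic is made exact by a renewal equation. The average of a test
    function over the paths with fewer than [n] jumps ([total]) splits according
    to the last jump before [t]; exponential waiting times may be listed
    backwards from [t], so that what precedes the last jump is again such an
    average, of the test function already averaged over the last shock
    ([piece_last_jump], [total_renewal]). The recursion this gives for the
    difference between two initial laws is solved by the thinned exponential law
    ([exponential_thinning], [total_contraction]). Letting [n] grow recovers the
    process, because many jumps before [t] are unlikely ([many_jumps_unlikely]).
    Test functions take values in the unit interval, so that all integrands are
    nonnegative and averages are exchanged by Tonelli's theorem.

    A stationary law is found by watching the process just before its jumps and
    reading the noise backwards. The states started in the distant past from the
    lower bound [f1] increase, those started from [f2] decrease, and all of them
    lie in one order interval, which is compact; so the former converge
    ([back_limit]). The law of the limit is invariant for the chain watched just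
    before its jumps ([exists_prejump_invariant]). As the jump times are
    memoryless, such a law satisfies the renewal equation of the process itself
    ([prejump_invariant_renewal]), hence is stationary ([time_avg_invariant]).

    All this concerns increasing test functions, whereas stationarity and
    uniqueness speak of all Borel sets. The link is that two probability measures
    agreeing on the increasing Borel sets are equal
    ([increasing_sets_determine]): up to small probability they live on a compact
    order interval ([borel_probability_tight]), inside which increasing and
    decreasing sets separate points from compact sets. Uniqueness then follows
    from the merging of averages. *)

(** * Metrics and countable bases *)

Lemma exists_expr_le (R : realType) (c e : R) : 0 <= c < 1 -> 0 < e ->
  exists n, c ^+ n <= e.
Proof.
move=> /andP[c0 c1] e0; have : c ^+ n @[n --> \oo] --> (0 : R).
  by apply: cvg_expr; rewrite ger0_norm.
move=> /cvgrPdist_le/(_ e e0)[n _ /(_ n (leqnn n))].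
by rewrite /= sub0r normrN ger0_norm ?exprn_ge0//; exists n.
Qed.

Section Metric.
Context (R : realType) (T : ptopologicalType) (dist : T -> T -> R).
Hypotheses (dist_metric : metric dist) (distT : induces_topology dist).

Lemma dist_refl x : dist x x = 0.
Proof. by have [_ h _ _] := dist_metric; apply/h. Qed.

Lemma dist_sym x y : dist x y = dist y x.
Proof. by have [_ _ h _] := dist_metric. Qed.

Lemma dist_triangle y x z : dist x z <= dist x y + dist y z.
Proof. by have [_ _ _ h] := dist_metric. Qed.

Lemma nbhs_ball_of (x : T) (e : R) : 0 < e -> nbhs x [set y | dist x y < e].
Proof. by move=> e0; rewrite distT; exists e. Qed.

Lemma ball_of_nbhs (x : T) (A : set T) :
  nbhs x A -> exists2 e, 0 < e & forall y, dist x y < e -> A y.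
Proof. by rewrite distT => -[e e0 eA]; exists e. Qed.

Lemma open_ball_of (x : T) (e : R) : open [set y | dist x y < e].
Proof.
rewrite openE => y /= xye; rewrite /interior distT.
exists (e - dist x y); rewrite /= ?subr_gt0// => z /= yz.
by have := dist_triangle y x z; lra.
Qed.

Lemma closed_ball_of (x : T) (e : R) : closed [set y | dist x y <= e].
Proof.
move=> y cy /=; apply/ler_addgt0Pr => r r0.
have [z [/= xz yz]] := cy _ (nbhs_ball_of y r0).
by have := dist_triangle z x y; rewrite (dist_sym z y); lra.
Qed.

Lemma exists_invS_lt (e : R) : 0 < e -> exists k : nat, k.+1%:R^-1 < e.
Proof.
move=> e0; have [N _ hN] := near_infty_natSinv_lt (PosNum e0).
by exists N; apply: (hN N) => /=.
Qed.

(** The points at distance at least [1/(k+1)] from the complement of [G]: an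
    exhaustion of an open set by closed sets, through which limits of measurable
    maps are handled. *)
Definition deep (G : set T) (k : nat) : set T :=
  [set x | forall y, dist x y < k.+1%:R^-1 -> G y].

Lemma closed_deep G k : closed (deep G k).
Proof.
rewrite /deep; set r := _^-1; move=> x cx y /= xy.
have e0 : 0 < r - dist x y by rewrite subr_gt0.
have [z [/= Gz xz]] := cx _ (nbhs_ball_of x e0).
by apply: Gz; have := dist_triangle x z y; rewrite (dist_sym z x); lra.
Qed.

Lemma open_bigcup_deep G : open G -> G = \bigcup_k deep G k.
Proof.
move=> oG; apply/seteqP; split=> x.
  move=> Gx; have /ball_of_nbhs[e e0 eG] : nbhs x G by exact: open_nbhs_nbhs.
  have [k ke] := exists_invS_lt e0.
  by exists k => // y /lt_trans/(_ ke); exact: eG.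
by move=> [k _] /(_ x); apply; rewrite dist_refl invr_gt0.
Qed.

Lemma cvg_distP (u : nat -> T) (l : T) : u @ \oo --> l <->
  (forall e, 0 < e -> exists N, forall n, (N <= n)%N -> dist l (u n) < e).
Proof.
split=> [ul e e0|h].
  by have [N _ hN] := ul _ (nbhs_ball_of l e0); exists N => n /hN.
move=> A /ball_of_nbhs[e e0 eA]; have [N hN] := h e e0.
by exists N => // n /= /hN; exact: eA.
Qed.

Lemma separable_dense_seq : separable T ->
  exists q : nat -> T, forall x e, 0 < e -> exists n, dist x (q n) < e.
Proof.
move=> [D cD dD].
have D0 : D !=set0.
  have [|x [_ Dx]] := dD setT _ openT; first by exists point.
  by exists x.
have [q qD] : exists q : nat -> T, D `<=` range q.
  move/countable_injP : cD => [f finj]; case: D0 => x0 Dx0.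
  exists (fun n => xget x0 [set x | D x /\ f x = n]) => x Dx.
  exists (f x) => //; case: xgetP => [y _ [Dy fyx]|/(_ x)]; last by case.
  by apply: finj => //; exact/mem_set.
exists q => x e e0; have [||y [/= xy Dy]] := dD [set y | dist x y < e].
- by exists x; rewrite /= dist_refl.
- exact: open_ball_of.
- by have [n _ qn] := qD _ Dy; exists n; rewrite qn.
Qed.

Definition rball (q : nat -> T) (p : nat * nat) : set T :=
  [set y | dist (q p.1) y < p.2.+1%:R^-1].

Lemma rball_basis (q : nat -> T) :
    (forall x e, 0 < e -> exists n, dist x (q n) < e) ->
  forall x A, nbhs x A -> exists2 p, rball q p x & rball q p `<=` A.
Proof.
move=> qd x A /ball_of_nbhs[e e0 eA].
have e20 : 0 < e / 2 by rewrite divr_gt0.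
have [k ke] := exists_invS_lt e20.
have k0 : 0 < k.+1%:R^-1 :> R by rewrite invr_gt0.
have [n nk] := qd x _ k0.
exists (n, k); rewrite /rball /=; first by rewrite dist_sym.
move=> y /= ny; apply: eA; move: nk ny ke; set r := _^-1.
by have := dist_triangle (q n) x y; lra.
Qed.

End Metric.

Section CountableBasis.
Context (T : topologicalType).

Definition cbasis (b : nat * nat -> set T) :=
  (forall p, open (b p)) /\
  forall x A, nbhs x A -> exists2 p, b p x & b p `<=` A.

End CountableBasis.

Lemma polish_cbasis (R : realType) (T : ptopologicalType) :
  polish R T -> exists b : nat * nat -> set T, cbasis b.
Proof.
move=> [sT [dist [dm dT _]]]; have [q qd] := separable_dense_seq dm dT sT.
exists (rball dist q); split=> [p|]; first exact: open_ball_of.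
exact: rball_basis.
Qed.

Lemma realType_cbasis (R : realType) : exists b : nat * nat -> set R, cbasis b.
Proof.
pose dist (x y : R) := `|x - y|.
have dm : metric dist.
  split=> [x y|x y|x y|x y z]; rewrite /dist //.
  - by split=> [/normr0_eq0/subr0_eq //|->]; rewrite subrr normr0.
  - exact: distrC.
  - by rewrite -[x - z](subrKA y) ler_normD.
have dT : induces_topology dist.
  by move=> x; rewrite -nbhs_ballE /nbhs_ball_ /ball/=.
have sT : separable R.
  exists (range (ratr : rat -> R)); last exact: dense_rat.
  exact: card_le_trans (card_image_le _ _) (countableP _).
have [q qd] := separable_dense_seq dm dT sT.
exists (rball dist q); split=> [p|]; first exact: open_ball_of.
exact: rball_basis.
Qed.

(** An open set of the product is a union of rectangles of basic open sets, and
    there are only countably many of those. *)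
Lemma measurable_open_prod d1 d2 (T1 : measurableType d1)
    (T2 : measurableType d2) (X1 X2 : topologicalType)
    (f1 : T1 -> X1) (f2 : T2 -> X2) (b1 : nat * nat -> set X1)
    (b2 : nat * nat -> set X2) :
  cbasis b1 -> cbasis b2 ->
  (forall A, open A -> measurable (f1 @^-1` A)) ->
  (forall A, open A -> measurable (f2 @^-1` A)) ->
  forall A : set (X1 * X2), open A ->
    measurable [set z : T1 * T2 | A (f1 z.1, f2 z.2)].
Proof.
move=> [ob1 hb1] [ob2 hb2] mf1 mf2 A oA.
pose U (pq : (nat * nat) * (nat * nat)) := if `[<b1 pq.1 `*` b2 pq.2 `<=` A>]
  then (f1 @^-1` b1 pq.1) `*` (f2 @^-1` b2 pq.2) else set0.
rewrite [X in measurable X](_ : _ = \bigcup_pq U pq).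
  apply: countable_bigcupT_measurable => // -[p q]; rewrite /U.
  by case: ifP => // _; apply: measurableX; [exact: mf1|exact: mf2].
apply/seteqP; split=> -[x y] /=.
  move=> Axy; have [[V W] /= [Vx Wy] VW] : nbhs (f1 x, f2 y) A.
    exact: open_nbhs_nbhs.
  have [p px pV] := hb1 _ _ Vx; have [q qy qW] := hb2 _ _ Wy.
  exists (p, q) => //; rewrite /U asboolT// => -[x' y'] [/pV ? /qW ?].
  exact: VW.
by move=> [[p q] _]; rewrite /U; case: ifP => // /asboolP h [/= px qy]; exact: h.
Qed.

(** * Tightness of Borel probability measures *)

Section Borel.
Context (T : ptopologicalType).

Lemma open_borel (A : set T) : open A -> measurable (A : set (borel T)).
Proof. by move=> oA; exact: sub_sigma_algebra. Qed.

Lemma closed_borel (A : set T) : closed A -> measurable (A : set (borel T)).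
Proof.
by move=> cA; rewrite -[A]setCK; apply: measurableC; apply: open_borel; rewrite openC.
Qed.

End Borel.

Section Tightness.
Context (R : realType) (T : ptopologicalType) (dist : T -> T -> R).
Hypotheses (dist_metric : metric dist) (distT : induces_topology dist).
Hypothesis dist_complete : complete_metric dist.

(** An ultrafilter on such a set contains one ball of each radius [1/(k+1)]. Any
    finitely many of these balls intersect, which yields a Cauchy sequence whose
    limit is also that of the ultrafilter. *)
Lemma totally_bounded_compact (q : nat -> T) (n : nat -> nat) :
  compact (\bigcap_k \bigcup_(i < n k) [set y | dist (q i) y <= k.+1%:R^-1]).
Proof.
set C := \bigcap_k _; rewrite compact_ultra => F UF FC.
pose B i k := [set y : T | dist (q i) y <= k.+1%:R^-1].
have /choice[i iF] : forall k, exists i, F (B i k).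
  move=> k; have : F (\bigcup_(i < n k) B i k).
    by apply: filterS FC => y /(_ k I).
  elim: (n k) => [|m IH].
    by rewrite bigcup_mkord big_ord0 => /filter_not_empty.
  rewrite bigcup_mkord big_ord_recr/= => FU.
  have [FB|FB] := in_ultra_setVsetC (B m k) UF; first by exists m.
  apply: IH; rewrite bigcup_mkord; apply: filterS (filterI FU FB) => y.
  by move=> [[|] //].
have /choice[u uB] : forall k, exists x, forall j, (j <= k)%N -> B (i j) j x.
  move=> k.
  have : F [set x | forall j : 'I_k.+1, B (i j) j x] by apply: filter_forall => j; exact: iF.
  by move=> /filter_ex[x xB]; exists x => j jk; exact: (xB (Ordinal (jk : (j < k.+1)%N))).
have Bdist j x y : B (i j) j x -> B (i j) j y -> dist x y <= 2 * j.+1%:R^-1.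
  rewrite /B /=; set r := _^-1; have := dist_triangle dist_metric (q (i j)) x y.
  by rewrite (dist_sym dist_metric x (q _)); lra.
have small (e : R) : 0 < e -> exists k : nat, 2 * k.+1%:R^-1 < e.
  move=> e0; have [//|k ke] := @exists_invS_lt R (e / 2); first by rewrite divr_gt0.
  by exists k; rewrite mulrC -ltr_pdivlMr.
have [e e0|l ul] := dist_complete (u := u).
  have [k ke] := small e e0; exists k => a b ka kb.
  by apply: le_lt_trans ke; apply: Bdist; exact: uB.
have Bl k : B (i k) k l.
  have cB : closed (B (i k) k) by exact: closed_ball_of.
  apply: (closed_cvg _ cB _ _ ul).
  by exists k => // m /= km; exact: uB.
have Fl : F --> l.
  move=> A /(ball_of_nbhs distT)[e e0 eA]; have [k ke] := small e e0.
  apply: filterS (iF k) => y /(Bdist _ _ _ (Bl k)) ly.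
  by apply: eA; exact: le_lt_trans ke.
exists l; split => //.
have cC : closed C.
  apply: closed_bigI => k _; rewrite bigcup_mkord.
  by apply: closed_bigsetU => j _; exact: closed_ball_of.
apply: cC => A /Fl FA; exact: (@filter_ex _ F _ _ (filterI FC FA)).
Qed.

(** Ulam's theorem. Finitely many balls of radius [1/(k+1)] carry all the mass
    but [e / 2 ^ (k+1)], and the intersection over [k] of their unions is
    compact. *)
Lemma borel_probability_tight (P : probability (borel T) R) (e : R) :
  separable T -> 0 < e ->
  exists C : set T, [/\ compact C, closed C & (P (~` C) <= e%:E)%E].
Proof.
move=> sT e0; have [q qd] := separable_dense_seq dist_metric distT sT.
pose B i k := [set y : T | dist (q i) y <= k.+1%:R^-1].
have mB i k : measurable (B i k : set (borel T)).
  by apply: closed_borel; exact: closed_ball_of.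
pose D k n : set (borel T) := ~` \bigcup_(i < n) B i k.
have mD k n : measurable (D k n).
  by apply: measurableC; apply: bigcup_measurable => i _.
have /choice[n nP] : forall k, exists n, (P (D k n) <= (e / (2 ^ k.+1)%:R)%:E)%E.
  move=> k.
  have : (P \o D k) n @[n --> \oo] --> P (\bigcap_n D k n).
    apply: nonincreasing_cvg_mu => //.
    - by rewrite (le_lt_trans (probability_le1 _ _)) ?ltry.
    - exact: bigcapT_measurable.
    - move=> a b ab; apply/subsetPset; apply: subsetC.
      by apply: bigcup_subset => j /= /leq_trans; apply.
  have -> : \bigcap_n D k n = set0.
    rewrite -subset0 => x xD; have [j xj] := qd x k.+1%:R^-1 (ltac:(by rewrite invr_gt0)).
    apply: (xD j.+1 I); exists j => //=.
    by rewrite /B /= (dist_sym dist_metric) ltW.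
  rewrite measure0 => Pc.
  have r0 : (0 < (e / (2 ^ k.+1)%:R)%:E)%E by rewrite lte_fin divr_gt0// ltr0n expn_gt0.
  have [N _ hN] := Pc _ (open_nbhs_nbhs (conj (@open_ereal_lt_ereal _ _) r0)).
  by exists N; apply: ltW; apply: (hN N) => /=.
exists (\bigcap_k \bigcup_(i < n k) B i k); split.
- exact: totally_bounded_compact.
- apply: closed_bigI => k _; rewrite bigcup_mkord.
  by apply: closed_bigsetU => j _; exact: closed_ball_of.
rewrite setC_bigcap.
apply: (@le_trans _ _ (\sum_(0 <= k <oo) P (D k (n k)))%E).
  apply: measure_sigma_subadditive => //.
  by apply: bigcup_measurable => k _; exact: mD.
apply: (le_trans _ (epsilon_trick0 xpredT (ltW e0))).
exact: lee_nneseries.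
Qed.

End Tightness.

(** * Closed partial orders *)

Section ClosedOrder.
Context (R : realType) (disp : Order.disp_t) (S : POrderedPointedTopological.type disp).
Variable dist : S -> S -> R.
Hypotheses (dist_metric : metric dist) (distS : induces_topology dist).
Hypothesis closed_le : closed_order S.

(** The complement of the order is open in the product: the order is closed
    under limits of sequences, and the topology is metrizable. *)
Lemma not_le_balls (a b : S) : ~ (a <= b)%O ->
  exists2 r, 0 < r & forall x y, dist a x < r -> dist b y < r -> ~ (x <= y)%O.
Proof.
move=> ab; apply: contrapT => h.
have /choice[xy xyP] : forall n : nat, exists p : S * S,
    [/\ dist a p.1 < n.+1%:R^-1, dist b p.2 < n.+1%:R^-1 & (p.1 <= p.2)%O].
  move=> n; apply: contrapT => hn; apply: h.
  exists n.+1%:R^-1; rewrite ?invr_gt0// => x y ax bx xy.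
  by apply: hn; exists (x, y).
have cvg (l : S) (u : nat -> S) :
    (forall n, dist l (u n) < n.+1%:R^-1) -> u @ \oo --> l.
  move=> lu; apply/(cvg_distP distS) => e e0.
  have [k ke] := exists_invS_lt e0; exists k => n kn.
  apply: lt_le_trans (lu n) _; apply: le_trans (ltW ke).
  by rewrite lef_pV2 ?posrE// ler_nat.
apply: ab; apply: (@closed_le (fst \o xy) (snd \o xy)).
- by move=> n; have [] := xyP n.
- by apply: cvg => n; have [] := xyP n.
- by apply: cvg => n; have [] := xyP n.
Qed.

Lemma closed_upset (a : S) : closed [set x : S | (a <= x)%O].
Proof.
move=> x cx; apply: contrapT => /not_le_balls[r r0 hr].
have [y [/= ay xy]] := cx _ (nbhs_ball_of distS x r0).
by apply: hr ay => //; rewrite (dist_refl dist_metric).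
Qed.

Lemma closed_downset (a : S) : closed [set x : S | (x <= a)%O].
Proof.
move=> x cx; apply: contrapT => /not_le_balls[r r0 hr].
have [y [/= ay xy]] := cx _ (nbhs_ball_of distS x r0).
by apply: hr ay => //; rewrite (dist_refl dist_metric).
Qed.

Lemma closed_order_interval (a b : S) : closed (order_interval a b).
Proof.
rewrite (_ : order_interval _ _ = [set x | (a <= x)%O] `&` [set x | (x <= b)%O]).
  by apply: closedI; [exact: closed_upset|exact: closed_downset].
by apply/seteqP; split=> x /= => [/andP[]//|[ax xb]]; exact/andP.
Qed.

(** Each point of [K] has a neighbourhood that stays incomparable with a
    neighbourhood of [y]; by compactness one neighbourhood of [y] serves all
    of [K]. *)
Lemma closed_upclosure (K : set S) : compact K ->
  closed [set y : S | exists2 x, K x & (x <= y)%O].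
Proof.
move=> /compact_near_coveringP cK y cy; apply: contrapT => ny.
have : \forall y' \near y, K `<=` (fun x => ~ (x <= y')%O).
  apply: cK => x Kx; have : ~ (x <= y)%O by move=> xy; apply: ny; exists x.
  move=> /not_le_balls[r r0 hr].
  exists ([set z | dist x z < r], [set z | dist y z < r]) => /=.
    by split; exact: nbhs_ball_of.
  by move=> [x' y'] /= [xx' yy']; exact: hr.
by move=> /cy[y' [[x Kx xy'] /(_ x Kx)]].
Qed.

Lemma closed_downclosure (K : set S) : compact K ->
  closed [set y : S | exists2 x, K x & (y <= x)%O].
Proof.
move=> /compact_near_coveringP cK y cy; apply: contrapT => ny.
have : \forall y' \near y, K `<=` (fun x => ~ (y' <= x)%O).
  apply: cK => x Kx; have : ~ (y <= x)%O by move=> xy; apply: ny; exists x.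
  move=> /not_le_balls[r r0 hr].
  exists ([set z | dist x z < r], [set z | dist y z < r]) => /=.
    by split; exact: nbhs_ball_of.
  by move=> [x' y'] /= [xx' yy']; exact: hr.
by move=> /cy[y' [[x Kx xy'] /(_ x Kx)]].
Qed.

Lemma open_not_le : open [set z : S * S | ~ (z.1 <= z.2)%O].
Proof.
rewrite openE => -[a b] /= /not_le_balls[r r0 hr].
exists ([set z | dist a z < r], [set z | dist b z < r]) => /=.
  by split; exact: nbhs_ball_of.
by move=> [x y] /= [ax bx]; exact: hr.
Qed.

Lemma measurable_le d (T : measurableType d) (f g : T -> borel S)
    (b : nat * nat -> set S) : cbasis b ->
  measurable_fun setT f -> measurable_fun setT g ->
  measurable [set w | ((f w : S) <= g w)%O].
Proof.
move=> cb mf mg; rewrite -[X in measurable X]setCK; apply: measurableC.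
have mle : measurable [set z : borel S * borel S | ~ ((z.1 : S) <= z.2)%O].
  exact: (@measurable_open_prod _ _ (borel S) (borel S) S S id id b b cb cb
    (@open_borel S) (@open_borel S) _ open_not_le).
rewrite -[X in measurable X]setTI.
exact: (measurable_fun_pair mf mg) measurableT _ mle.
Qed.

(** Monotone sequences in a compact order interval converge: two cluster points
    of such a sequence bound each other, since each bounds all its terms. *)
Lemma nondecreasing_compact_cvg (u : nat -> S) (a b : S) :
  compact (order_interval a b) -> (forall n, (u n <= u n.+1)%O) ->
  (forall n, order_interval a b (u n)) ->
  exists2 l, u @ \oo --> l & forall n, (u n <= l)%O.
Proof.
move=> cab ndu uab.
have ndu' m n : (m <= n)%N -> (u m <= u n)%O.
  by move=> /subnK <-; elim: (n - m)%N => // k IH; rewrite addSn (le_trans IH).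
have ubcl l : cluster (u @ \oo) l -> forall n, (u n <= l)%O.
  move=> cl n; apply: (closed_upset (a := u n)) => A Al.
  apply: cl Al; exists n => // m /=; exact: ndu'.
have lecl l l' : cluster (u @ \oo) l -> cluster (u @ \oo) l' -> (l' <= l)%O.
  move=> cl cl'; apply: (closed_downset (a := l)) => A Al'.
  by apply: cl' Al'; exists 0%N => // m _ /=; exact: ubcl.
have uF : (u @ \oo) (order_interval a b) by exists 0%N => // n _; exact: uab.
have [l [_ cl]] := cab (u @ \oo) _ uF.
exists l; last exact: ubcl.
move=> A Al; wlog oA : A Al / open A.
  move=> h; move: Al; rewrite nbhsE => -[B [oB Bl] BA].
  by apply: filterS BA _; apply: h => //; exact: open_nbhs_nbhs.
have /compact_near_coveringP cK : compact (order_interval a b `&` ~` A).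
  by apply: compact_closedI => //; rewrite closedC.
have : \forall n \near \oo, (order_interval a b `&` ~` A) `<=` (fun x => u n <> x).
  apply: cK => x [_ Ax].
  apply: contrapT => hx; apply: Ax; suff -> : x = l by exact: nbhs_singleton.
  suff cx : cluster (u @ \oo) x by apply/le_anti/andP; split; exact: lecl.
  move=> D B FD Bx; apply: contrapT => DB0; apply: hx.
  exists (B, u @^-1` D) => //= -[y n] /= [By Dn] uny.
  by apply: DB0; exists y; split => //; rewrite -uny.
apply: filterS => n h /=; apply: contrapT => nA.
exact: (h (u n)).
Qed.

End ClosedOrder.

(** * Increasing sets determine a probability measure *)

Section Determination.
Context (R : realType) (disp : Order.disp_t) (S : POrderedPointedTopological.type disp).
Hypotheses (polish_S : polish R S) (closed_le : closed_order S).
Hypothesis compactE : forall A : set S, compact A <-> closed A /\ order_bounded A.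

Definition increasing_set (A : set S) := forall x y : S, (x <= y)%O -> A x -> A y.

Definition increasing_borel : set (set S) :=
  [set A | measurable (A : set (borel S)) /\ increasing_set A].

Notation sI := (@measurable _ (g_sigma_algebraType increasing_borel)).

Let sI_increasing (A : set S) : closed A \/ open A -> increasing_set A -> sI A.
Proof.
move=> oA iA; apply: sub_sigma_algebra; split => //.
by case: oA => h; [exact: closed_borel|exact: open_borel].
Qed.

Let sI_decreasing (A : set S) : closed A ->
  (forall x y, (x <= y)%O -> A y -> A x) -> sI A.
Proof.
move=> cA iA; rewrite -[A]setCK; apply: measurableC; apply: sI_increasing.
  by right; rewrite openC.
by move=> x y xy nAx Ay; apply: nAx; exact: iA Ay.
Qed.

Let sI_interval (a b : S) : sI (order_interval a b).
Proof.
have [_ [dist [dm dS _]]] := polish_S.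
rewrite (_ : order_interval _ _ = [set x | (a <= x)%O] `&` [set x | (x <= b)%O]).
  apply: measurableI.
    apply: sI_increasing => [|x y xy /= /le_trans]; last exact.
    by left; exact: closed_upset dm dS _ _.
  by apply: sI_decreasing => [|x y xy /= /(le_trans xy)//]; exact: closed_downset dm dS _ _.
by apply/seteqP; split=> x /= => [/andP[]//|[ax xb]]; exact/andP.
Qed.

(** Each [x] in [K] fails [x <= y] or [y <= x]. Accordingly the up-closure or the
    down-closure of a compact neighbourhood of [x] in [K] misses [y], and finitely
    many such neighbourhoods cover [K]. *)
Let sI_separates (K : set S) y : compact K -> ~ K y ->
  exists J, [/\ closed J, sI J, K `<=` J & ~ J y].
Proof.
have [_ [dist [dm dS _]]] := polish_S.
move=> cK nKy.
have /choice[e he] : forall x, exists e, 0 < e /\ (K x -> exists J,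
    [/\ closed J, sI J, [set z | K z /\ dist x z < e] `<=` J & ~ J y]).
  move=> x; have [Kx|nKx] := pselect (K x); last by exists 1; split.
  have cN (r : R) : compact (K `&` [set z | dist x z <= r]).
    by apply: compact_closedI => //; exact: closed_ball_of.
  have : ~ (x <= y)%O \/ ~ (y <= x)%O.
    have [xy|] := pselect (x <= y)%O; last by left.
    right => yx; apply: nKy; suff <- : x = y by [].
    by apply/le_anti/andP.
  case=> /(not_le_balls dS closed_le)[r r0 hr]; (exists (r / 2); split; first by rewrite divr_gt0) => _.
  - exists [set w | exists2 z, (K `&` [set z | dist x z <= r / 2]) z & (z <= w)%O]; split.
    + exact: (closed_upclosure dS closed_le (cN _)).
    + apply: sI_increasing.
        by left; exact: (closed_upclosure dS closed_le (cN _)).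
      by move=> w w' ww' [z Kz zw]; exists z => //; exact: le_trans ww'.
    + by move=> z [Kz xz]; exists z => //; split => //=; exact: ltW.
    + move=> [z [_ /= xz]]; apply: hr; last by rewrite dist_refl.
      by rewrite (le_lt_trans xz)// ltr_pdivrMr// ltr_pMr// ltr1n.
  - exists [set w | exists2 z, (K `&` [set z | dist x z <= r / 2]) z & (w <= z)%O]; split.
    + exact: (closed_downclosure dS closed_le (cN _)).
    + apply: sI_decreasing; first exact: (closed_downclosure dS closed_le (cN _)).
      by move=> w w' ww' [z Kz zw]; exists z => //; exact: le_trans zw.
    + by move=> z [Kz xz]; exists z => //; split => //=; exact: ltW.
    + move=> [z [_ /= xz]]; apply: hr; first by rewrite dist_refl.
      by rewrite (le_lt_trans xz)// ltr_pdivrMr// ltr_pMr// ltr1n.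
have /choice[J hJ] : forall x, exists J, K x ->
    [/\ closed J, sI J, [set z | K z /\ dist x z < e x] `<=` J & ~ J y].
  move=> x; have [Kx|nKx] := pselect (K x); last by exists set0.
  by have [_ /(_ Kx)[J HJ]] := he x; exists J.
move: (cK); rewrite compact_cover => /(_ S K (fun x => [set z | dist x z < e x])).
case=> [x _|x Kx|D' D'K KD'].
- exact: open_ball_of.
- by exists x => //=; rewrite (dist_refl dm); have [] := he x.
have {}D'K x : x \in D' -> K x by move=> /D'K/set_mem.
exists (\bigcup_(x in [set` D']) J x); split.
- apply: closed_bigcup => [|x /= xD']; first exact: finite_fset.
  by have [] := hJ _ (D'K _ xD').
- apply: fin_bigcup_measurable => [|x /= xD']; first exact: finite_fset.
  by have [] := hJ _ (D'K _ xD').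
- move=> z Kz; have [x /= xD' xz] := KD' _ Kz.
  by exists x => //; have [_ _ + _] := hJ _ (D'K _ xD'); apply.
- by move=> [x /= xD']; have [] := hJ _ (D'K _ xD').
Qed.

(** The trace of [H] on the interval is compact, so each point outside it has a
    basic neighbourhood missing some closed member of the sigma-algebra that
    contains the trace. There are only countably many basic open sets, so that
    countably many such members cut the trace out of the interval. *)
Let sI_closed_interval (a b : S) (H : set S) : compact (order_interval a b) ->
  closed H -> sI (H `&` order_interval a b).
Proof.
move=> cab cH; set C := order_interval a b.
have [B [oB hB]] := polish_cbasis polish_S.
have cK : compact (H `&` C) by rewrite setIC; exact: compact_closedI.
pose good p J := [/\ sI J, H `&` C `<=` J & B p `<=` ~` J].
have /choice[J hJ] : forall p, exists J, (exists J', good p J') -> good p J.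
  move=> p; have [[J' gJ']|nJ] := pselect (exists J', good p J').
    by exists J'.
  by exists set0.
pose V p := if `[<exists J', good p J'>] then ~` J p else set0.
have -> : H `&` C = C `\` \bigcup_p V p.
  apply/seteqP; split=> [x [Hx Cx]|x [Cx nx]].
    split=> // -[p _]; rewrite /V; case: ifPn => // /asboolP gp; apply.
    by have [_ + _] := hJ p gp; apply.
  split=> //; apply: contrapT => Hx; apply: nx.
  have [|J' [cJ' sJ' KJ' nJ'x]] := sI_separates (y := x) cK; first by case.
  have [|p px pJ'] := hB x (~` J').
    by apply: open_nbhs_nbhs; split => //; rewrite openC.
  have gp : exists J', good p J' by exists J'.
  by exists p => //; rewrite /V asboolT//; have [_ _] := hJ p gp; apply.
apply: measurableD; first exact: sI_interval.
apply: countable_bigcupT_measurable => // p; rewrite /V.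
by case: ifPn => // /asboolP gp; apply: measurableC; have [] := hJ p gp.
Qed.

Let sI_determined (m1 m2 : probability (borel S) R) :
  (forall A : set S, increasing_borel A -> m1 A = m2 A) ->
  forall A : set S, sI A -> m1 A = m2 A.
Proof.
move=> m12 A sA.
apply: (@g_sigma_algebra_measure_unique _ R (borel S) increasing_borel _ (fun=> setT) _ _ m1 m2 _ _ _ A sA) => //.
- by move=> B [].
- by rewrite bigcup_const.
- move=> B B' [mB iB] [mB' iB']; split; first exact: measurableI.
  by move=> x y xy [Bx B'x]; split; [exact: iB Bx|exact: iB' B'x].
- by move=> _; rewrite (le_lt_trans (probability_le1 _ _)) ?ltry.
Qed.

(** The increasing Borel sets are stable under intersection, so two probability
    measures agreeing on them agree on the sigma-algebra they generate. Up to a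
    set of small measure, tightness confines everything to one compact order
    interval, and there the generated sigma-algebra contains all closed sets. *)
Lemma increasing_sets_determine (m1 m2 : probability (borel S) R) :
  (forall A : set S, increasing_borel A -> m1 A = m2 A) ->
  forall A : set (borel S), measurable A -> m1 A = m2 A.
Proof.
move=> m12.
have cl_le (p1 p2 : probability (borel S) R) (H : set S) :
    (forall A : set S, increasing_borel A -> p1 A = p2 A) -> closed H ->
    (p1 H <= p2 H)%E.
  move=> p12 cH; apply/lee_addgt0Pr => e e0.
  have [sS [dist [dm dS cS]]] := polish_S.
  have [K [cK clK PK]] := borel_probability_tight dm dS cS p1 sS e0.
  have [_ [a [b [ab Kab]]]] := (compactE K).1 cK.
  have cab : compact (order_interval a b).
    apply/compactE; split; first exact: closed_order_interval dm dS closed_le _ _.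
    by exists a, b; split.
  have mH : measurable (H : set (borel S)) by exact: closed_borel.
  have mK : measurable (K : set (borel S)) by exact: closed_borel.
  have mC : measurable (order_interval a b : set (borel S)).
    by apply: closed_borel; exact: closed_order_interval dm dS closed_le _ _.
  have sHC := sI_closed_interval cab cH.
  apply: (@le_trans _ _ (p1 (H `&` order_interval a b) + p1 (~` K))%E).
    have mHC : measurable (H `&` order_interval a b : set (borel S)).
      exact: measurableI.
    have mKc : measurable (~` K : set (borel S)) by exact: measurableC.
    apply: (le_trans _ (measureU2 p1 mHC mKc)).
    apply: le_measure; [exact/mem_set|exact/mem_set/measurableU|].
    move=> x Hx; have [Kx|nKx] := pselect (K x); last by right.
    by left; split => //; exact: Kab.
  apply: leeD => //; rewrite (sI_determined p12 sHC).
  by apply: le_measure; [exact/mem_set/measurableI|exact/mem_set|].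
have cl_eq (H : set S) : closed H -> m1 H = m2 H.
  move=> cH; apply/le_anti/andP; split; apply: cl_le => // A iA.
  exact/esym/m12.
move=> A mA; apply: (@measure_unique _ R (borel S) (@open S) (fun=> setT) _ _ _ _ m1 m2 _ _ A mA) => //.
- exact: openI.
- by move=> _; exact: openT.
- by rewrite bigcup_const.
- move=> G oG; rewrite -[G]setCK.
  have mG : measurable (~` G : set (borel S)).
    by apply: closed_borel; rewrite closedC.
  have pC (p : probability (borel S) R) : p (~` (~` G)) = (1 - p (~` G))%E.
    exact: probability_setC.
  apply: (etrans (pC m1)); apply/esym; apply: (etrans (pC m2)).
  by congr (1 - _)%E; apply/esym/cl_eq; rewrite closedC.
- by move=> _; rewrite (le_lt_trans (probability_le1 _ _)) ?ltry.
Qed.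

End Determination.

(** * The exponential law *)

Section Substitution.
Context (R : realType).
Local Notation leb := (@lebesgue_measure R).
Local Open Scope ereal_scope.

Let ge0_integral_lebesgue_image (phi : measurableTypeR R -> measurableTypeR R)
    (q : R -> \bar R) :
  measurable_fun [set: measurableTypeR R] phi ->
  (forall x y : R, leb (phi @^-1` `]x, y]) = leb `]x, y]) ->
  measurable_fun [set: R] q -> (forall x, 0 <= q x) ->
  \int[leb]_x q (phi x) = \int[leb]_x q x.
Proof.
move=> mphi hphi mq q0.
rewrite -(ge0_integral_pushforward mphi leb (D := setT))//.
apply: eq_measure_integral => A mA _ /=; apply/esym.
apply: (lebesgue_measure_unique (mu := pushforward leb phi)) => //.
by move=> _ [[x y] _ <-] /=; rewrite /pushforward hphi.
Qed.

Lemma ge0_integral_lebesgueD (a : R) (q : R -> \bar R) :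
  measurable_fun [set: R] q -> (forall x, 0 <= q x) ->
  \int[leb]_x q (a + x)%R = \int[leb]_x q x.
Proof.
apply: ge0_integral_lebesgue_image; first exact: measurable_funD.
move=> x y; rewrite [X in leb X = _](_ : _ = (`](x - a)%R, (y - a)%R]%classic)); last first.
  by apply/seteqP; split=> z /=; rewrite !in_itv/= ltrBlDl lerBrDl.
rewrite !lebesgue_measure_itv/= !lte_fin ltrD2r; case: ifPn => // _.
by rewrite -!EFinD; congr (_%:E); lra.
Qed.

Lemma ge0_integral_lebesgueN (q : R -> \bar R) :
  measurable_fun [set: R] q -> (forall x, 0 <= q x) ->
  \int[leb]_x q (- x)%R = \int[leb]_x q x.
Proof.
apply: ge0_integral_lebesgue_image.
  by apply: (continuous_measurable_fun (f := -%R : R -> R)); exact: opp_continuous.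
by move=> x y; exact: lebesgue_measureN.
Qed.

Lemma ge0_integral_lebesgueB (a : R) (q : R -> \bar R) :
  measurable_fun [set: R] q -> (forall x, 0 <= q x) ->
  \int[leb]_x q (a - x)%R = \int[leb]_x q x.
Proof.
move=> mq q0; rewrite -[RHS](ge0_integral_lebesgueD a)//.
rewrite -(ge0_integral_lebesgueN (q := fun x => q (a + x)%R))//.
by apply: measurableT_comp => //; exact: measurable_funD.
Qed.

End Substitution.

Section ExponentialLaw.
Context (R : realType).
Local Notation leb := (@lebesgue_measure R).

(** The tail of the exponential law on nonnegative times. Cutting it off to [0]
    elsewhere, through a product, lets integrals over the paths or ages up to
    time [t] run over the whole space, with no restriction of the domain. *)
Definition survival (c t : R) : R := (0 <= t)%R%:R * expR (- (c * t)).

Lemma surv_ge0 c t : 0 <= survival c t.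
Proof. by rewrite mulr_ge0 ?expR_ge0. Qed.

Lemma surv_lt0 c t : t < 0 -> survival c t = 0.
Proof. by rewrite /survival leNgt => ->; rewrite mul0r. Qed.

Lemma surv_pos c t : 0 <= t -> survival c t = expR (- (c * t)).
Proof. by rewrite /survival => ->; rewrite mul1r. Qed.

Lemma surv_le1 c t : 0 <= c -> survival c t <= 1.
Proof.
move=> c0; have [t0|t0] := ltP t 0; first by rewrite surv_lt0.
by rewrite surv_pos// expR_le1 oppr_le0 mulr_ge0.
Qed.

Lemma measurable_ge0 : measurable_fun [set: R] (fun t : R => (0 <= t)%R%:R : R).
Proof.
rewrite (_ : (fun _ => _) = \1_(`[0, +oo[%classic : set R)).
  exact: measurable_indic.
by apply/funext => t; rewrite indicE; congr (nat_of_bool _)%:R; rewrite mem_setE in_itv/= andbT.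
Qed.

Lemma measurable_surv c : measurable_fun [set: R] (survival c).
Proof.
apply: measurable_funM; first exact: measurable_ge0.
apply: measurableT_comp; first exact: measurable_expR.
by apply: measurableT_comp => //; exact: measurable_funM.
Qed.

Lemma exponential_pdf_surv c t : exponential_pdf c t = c * survival c t.
Proof.
have [t0|t0] := ltP t 0; first by rewrite lt0_exponential_pdf// surv_lt0// mulr0.
by rewrite exponential_pdfE// surv_pos// mulNr.
Qed.

Local Open Scope ereal_scope.

(** The density of the law is taken with respect to Lebesgue measure, which lives
    on the sigma-algebra generated by the half-open intervals; a law on the Borel
    sets of [R] is transported there along the identity. *)
Let ge0_integral_exponential_ocitv (c : R) (nu : probability (measurableTypeR R) R)
    (q : R -> \bar R) : (0 < c)%R ->
  (forall A, measurable A -> nu A = exponential_prob c A) ->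
  measurable_fun [set: R] q -> (forall x, 0 <= q x) ->
  \int[nu]_x q x = c%:E * \int[leb]_x ((survival c x)%:E * q x).
Proof.
move=> c_gt0 nuE mq q0.
have nu_dom : nu `<< leb.
  apply/null_content_dominatesP => A mA A0; rewrite nuE// /exponential_prob.
  apply: null_set_integral => //.
  by apply/measurable_funTS/measurableT_comp => //; exact: measurable_exponential_pdf.
have ms : measurable_fun [set: R] (fun x : R => (survival c x)%:E).
  by apply/measurable_EFinP; exact: measurable_surv.
rewrite -ge0_integralZl//; last 3 first.
- exact: emeasurable_funM.
- by move=> x _; rewrite mule_ge0// lee_fin surv_ge0.
- by rewrite lee_fin ltW.
rewrite -(Radon_Nikodym_SigmaFinite.change_of_variables nu_dom)//.
set f := Radon_Nikodym_SigmaFinite.f _ _.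
have fi := Radon_Nikodym_SigmaFinite.f_integrable nu_dom.
have mp : measurable_fun [set: R] (EFin \o exponential_pdf c).
  by apply/measurable_EFinP; exact: measurable_exponential_pdf.
have fE : ae_eq leb setT f (EFin \o exponential_pdf c).
  apply: integral_ae_eq => // A _ mA.
  by rewrite -Radon_Nikodym_SigmaFinite.f_integral//= nuE.
apply: ge0_ae_eq_integral => //.
- by apply: emeasurable_funM => //; exact: measurable_int fi.
- by apply: emeasurable_funM => //; exact: emeasurable_funM.
- move=> x _; apply: mule_ge0 => //; exact: Radon_Nikodym_SigmaFinite.f_ge0.
- by move=> x _; rewrite !mule_ge0// lee_fin ?surv_ge0// ltW.
- apply: filterS fE => x /= h _.
  by rewrite h// exponential_pdf_surv EFinM muleC muleA.
Qed.

Context (c : R) (c_gt0 : (0 < c)%R) (nu : probability R R).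
Hypothesis nuE : forall A, measurable A -> nu A = exponential_prob c A.

Lemma ge0_integral_exponential (q : R -> \bar R) :
  measurable_fun [set: R] q -> (forall x, 0 <= q x) ->
  \int[nu]_x q x = c%:E * \int[leb]_x ((survival c x)%:E * q x).
Proof.
move=> mq q0; pose phi (x : R) : measurableTypeR R := x.
have mphi : measurable_fun [set: R] phi by move=> _ A mA; rewrite setTI.
pose X : {mfun R >-> measurableTypeR R} := HB.pack phi (isMeasurableFun.Build _ _ _ _ _ mphi).
rewrite -(ge0_integral_exponential_ocitv (nu := distribution nu X))//.
by rewrite [RHS]ge0_integral_pushforward.
Qed.

(** Reflection of the last waiting time: its density is exponential, and so is
    the chance of no further jump. *)
Lemma exponential_reflection (q : R -> \bar R) (t : R) :
  measurable_fun [set: R] q -> (forall x, 0 <= q x) ->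
  \int[nu]_x ((survival c (t - x))%:E * q x) =
  \int[nu]_x ((survival c (t - x))%:E * q (t - x)%R).
Proof.
move=> mq q0.
have mB : measurable_fun [set: R] (fun x : R => t - x)%R by exact: measurable_funB.
have ms : measurable_fun [set: R] (fun x : R => (survival c x)%:E).
  by apply/measurable_EFinP; exact: measurable_surv.
have msB : measurable_fun [set: R] (fun x : R => (survival c (t - x))%:E).
  exact: (measurableT_comp ms mB).
have s0 x : 0 <= (survival c x)%:E by rewrite lee_fin surv_ge0.
rewrite ge0_integral_exponential//; last 2 first.
- exact: emeasurable_funM.
- by move=> x; exact: mule_ge0.
rewrite [RHS]ge0_integral_exponential//; last 2 first.
- by apply: emeasurable_funM => //; exact: (measurableT_comp mq mB).
- by move=> x; exact: mule_ge0.
congr (_ * _).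
rewrite -[LHS](ge0_integral_lebesgueB t); last 2 first.
- by apply: emeasurable_funM => //; exact: emeasurable_funM.
- by move=> x; rewrite !mule_ge0.
by apply: eq_integral => x _; rewrite subKr muleCA.
Qed.

Lemma exponential_lt0 : nu [set x | x < 0]%R = 0.
Proof.
rewrite nuE; last by rewrite -[X in measurable X]set_itvNyo; exact: measurable_itv.
rewrite /exponential_prob integral0_eq// => x /= x0.
by rewrite lt0_exponential_pdf.
Qed.

(** Given that it exceeds [t], an exponential time is distributed as [t] plus an
    exponential time. *)
Lemma memoryless (q : R -> \bar R) (t : R) : (0 <= t)%R ->
  measurable_fun [set: R] q -> (forall x, 0 <= q x) ->
  \int[nu]_x q x = \int[nu]_x (((0 <= t - x)%R%:R : R)%:E * q x) +
                   (survival c t)%:E * \int[nu]_x q (t + x)%R.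
Proof.
move=> t0 mq q0.
have mB : measurable_fun [set: R] (fun x : R => t - x)%R by exact: measurable_funB.
have mD : measurable_fun [set: R] (fun x : R => t + x)%R by exact: measurable_funD.
have ms : measurable_fun [set: R] (fun x : R => (survival c x)%:E).
  by apply/measurable_EFinP; exact: measurable_surv.
have mH : measurable_fun [set: R] (fun x : R => ((0 <= x)%R%:R : R)%:E).
  by apply/measurable_EFinP; exact: measurable_ge0.
have mHB : measurable_fun [set: R] (fun x : R => ((0 <= t - x)%R%:R : R)%:E).
  exact: (measurableT_comp mH mB).
have s0 x : 0 <= (survival c x)%:E by rewrite lee_fin surv_ge0.
have H0 (b : bool) : 0 <= (b%:R : R)%:E by rewrite lee_fin.
have cE0 : 0 <= c%:E by rewrite lee_fin ltW.
rewrite !ge0_integral_exponential//; last 3 first.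
- exact: (measurableT_comp mq mD).
- exact: emeasurable_funM.
- by move=> x; exact: mule_ge0.
rewrite muleCA -muleDr//; last first.
  apply: ge0_adde_def; rewrite inE; last apply: mule_ge0 => //.
    by apply: integral_ge0 => x _; rewrite !mule_ge0.
  by apply: integral_ge0 => x _; rewrite !mule_ge0.
congr (_ * _).
rewrite -ge0_integralZl//; last 2 first.
- by apply: emeasurable_funM => //; exact: (measurableT_comp mq mD).
- by move=> x _; exact: mule_ge0.
pose q2 (x : R) := (survival c t)%:E * ((survival c (x - t))%:E * q x).
have mq2 : measurable_fun [set: R] q2.
  apply: measurable_funeM; apply: emeasurable_funM => //.
  have mBt : measurable_fun [set: R] (fun x : R => x - t)%R by exact: measurable_funB.
  exact: (measurableT_comp ms mBt).
have q20 x : 0 <= q2 x by rewrite !mule_ge0.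
have -> : \int[leb]_x ((survival c t)%:E * ((survival c x)%:E * q (t + x)%R)) = \int[leb]_x q2 x.
  rewrite -[RHS](ge0_integral_lebesgueD t)//.
  by apply: eq_integral => x _; rewrite /q2 addrC addrK.
have mq1 : measurable_fun [set: R]
    (fun x : R => (survival c x)%:E * (((0 <= t - x)%R%:R : R)%:E * q x)).
  by apply: emeasurable_funM => //; exact: emeasurable_funM.
rewrite -ge0_integralD//; last by move=> x _; rewrite !mule_ge0.
apply: ge0_ae_eq_integral => //.
- exact: emeasurable_funM.
- exact: emeasurable_funD.
- by move=> x _; rewrite mule_ge0.
- by move=> x _; rewrite adde_ge0// !mule_ge0.
exists [set t]; split; first exact: measurable_set1.
  exact: lebesgue_measure_set1.
move=> x /= hx; apply: contrapT => xt; apply: hx => _; rewrite /q2.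
have [tx|tx|/esym//] := ltgtP t x.
- rewrite subr_ge0 leNgt tx/= mul0e mule0 add0e muleA -EFinM; congr (_%:E * _).
  rewrite !surv_pos ?subr_ge0// ?(ltW tx)//; last exact: le_trans (ltW tx).
  by rewrite -expRD; congr expR; lra.
- by rewrite subr_ge0 (ltW tx) mul1e (surv_lt0 _ (_ : x - t < 0)%R) ?subr_lt0// mul0e mule0 adde0.
Qed.

Lemma exponential_gt (t : R) : (0 <= t)%R -> nu [set x | t < x]%R = (survival c t)%:E.
Proof.
move=> t0; have mt : measurable [set x : R | t < x]%R.
  by rewrite (_ : [set _ | _] = `]t, +oo[%classic); [exact: measurable_itv|rewrite set_itvoy].
have := memoryless t0 (measurable_cst (1 : \bar R)) (fun=> lee01).
rewrite !integral_cst//= !mul1e probability_setT mule1 => h.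
have mC : measurable [set x : R | x <= t]%R.
  by rewrite (_ : [set _ | _] = `]-oo, t]%classic); [exact: measurable_itv|rewrite set_itvNyc].
have -> : [set x | t < x]%R = ~` [set x | x <= t]%R.
  by apply/seteqP; split=> x /=; rewrite ltNge => /negP.
rewrite probability_setC// h.
rewrite [X in X + _ - _](_ : _ = nu [set x | x <= t]%R); last first.
  rewrite -[X in _ = nu X]setIT -integral_indic//; apply: eq_integral => x _.
  by rewrite mule1 subr_ge0 indicE mem_setE.
by rewrite addeAC subee ?add0e// fin_num_measure.
Qed.

(** Thinning: if each jump independently counts with probability [p], the first
    counting jump is exponential with the thinned rate. *)
Lemma exponential_thinning (p t : R) : (0 < p < 1)%R -> (0 <= t)%R ->
  (survival c t)%:E + (1 - p)%:E * \int[nu]_x (survival (c * p) (t - x))%:E =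
  (survival (c * p) t)%:E.
Proof.
move=> /andP[p0 p1] t0.
have c'0 : (0 < c * (1 - p))%R by rewrite mulr_gt0// subr_gt0.
have mB : measurable_fun [set: R] (fun x : R => t - x)%R by exact: measurable_funB.
have msB : measurable_fun [set: R] (fun x : R => (survival (c * p) (t - x))%:E).
  have ms : measurable_fun [set: R] (fun x : R => (survival (c * p) x)%:E).
    by apply/measurable_EFinP; exact: measurable_surv.
  exact: (measurableT_comp ms mB).
have s0 k x : 0 <= (survival k x)%:E by rewrite lee_fin surv_ge0.
rewrite ge0_integral_exponential// muleA -EFinM -ge0_integralZl//; last 3 first.
- by apply: emeasurable_funM => //; apply/measurable_EFinP; exact: measurable_surv.
- by move=> x _; exact: mule_ge0.
- by rewrite lee_fin mulrC ltW.
pose f x : \bar R := (survival (c * p) t)%:E * (exponential_pdf (c * (1 - p)) x)%:E.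
rewrite [X in _ + X](_ : _ = \int[leb]_(x in `[0%R, t]) f x); last first.
  rewrite [RHS]integral_mkcond; apply: eq_integral => x _; rewrite patchE /f.
  rewrite mem_setE in_itv/=; case: ifPn => [/andP[x0 xt]|].
    rewrite exponential_pdf_surv !surv_pos ?subr_ge0// -!EFinM; congr _%:E.
    have : (expR (- (c * x)) * expR (- (c * p * (t - x))) =
            expR (- (c * p * t)) * expR (- (c * (1 - p) * x)))%R.
      by rewrite -!expRD; congr expR; ring.
    by move=> h; rewrite h; ring.
  rewrite negb_and -!ltNge => /orP[x0|xt].
    by rewrite (surv_lt0 c x0) mul0e mule0.
  by rewrite (surv_lt0 (c * p) (_ : t - x < 0)%R) ?subr_lt0// !mule0.
rewrite /f ge0_integralZl//; last 2 first.
- by apply/measurable_EFinP/measurable_funTS; exact: measurable_exponential_pdf.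
- by move=> x _; rewrite lee_fin exponential_pdf_ge0// ltW.
rewrite -/(exponential_prob (c * (1 - p)) `[0%R, t]).
have -> : exponential_prob (c * (1 - p)) `[0%R, t] = (1 - (expR (- (c * (1 - p)) * t))%:E).
  have [t1|t1] := ltP 0%R t; first exact: exponential_prob_itv0c.
  have -> : t = 0%R by apply/le_anti/andP.
  by rewrite /exponential_prob set_itv1 integral_set1 mulr0 expR0 subee.
rewrite !surv_pos// -EFinB -EFinM -EFinD mulrBr mulr1 -expRD; congr _%:E.
rewrite [X in (_ + (_ - expR X))%R](_ : _ = - (c * t))%R; last by ring.
by rewrite addrC subrK.
Qed.

End ExponentialLaw.

(** * Independence of known and future noise *)

Section Independence.
Context (R : realType) d (Omega : measurableType d) (P : probability Omega R).
Context (I : choiceType) (G : I -> set (set Omega)).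
Hypothesis indG : mutually_independent P G.
Hypothesis mG : forall i, G i `<=` measurable.
Hypothesis GT : forall i, G i setT.
Hypothesis GI : forall i, setI_closed (G i).

Definition cylinders (D : set I) : set (set Omega) :=
  [set C | exists J A, [/\ uniq J, forall i, i \in J -> D i,
     forall i, G i (A i) & C = \bigcap_(i in [set` J]) A i]].

Lemma cylindersT D : cylinders D setT.
Proof.
by exists [::], (fun=> setT); split => //; rewrite set_nil bigcap_set0.
Qed.

Lemma sub_cylinders (D : set I) i A : D i -> G i A -> cylinders D A.
Proof.
move=> Di GA; exists [:: i], (fun j => if pselect (j = i) then A else setT); split => //.
- by move=> j; rewrite inE => /eqP ->.
- by move=> j; case: pselect => /= [->|].
- rewrite (_ : [set` [:: i]] = [set i]); last first.
    by apply/seteqP; split=> j /=; rewrite inE => /eqP.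
  by rewrite bigcap_set1; case: pselect.
Qed.

Lemma cylinders_sub D : cylinders D `<=` measurable.
Proof.
move=> _ [J [A [uJ JD GA ->]]]; apply: fin_bigcap_measurable => // i _.
exact: mG.
Qed.

Lemma cylindersS (D D' : set I) : D `<=` D' -> cylinders D `<=` cylinders D'.
Proof. by move=> DD' C [J [A [uJ JD GA ->]]]; exists J, A; split => // i /JD/DD'. Qed.

Lemma cylindersI D : setI_closed (cylinders D).
Proof.
move=> _ _ [J1 [A1 [u1 J1D G1 ->]]] [J2 [A2 [u2 J2D G2 ->]]].
pose B (J : seq I) (A : I -> set Omega) i := if i \in J then A i else setT.
have GB J A i : G i (A i) -> G i (B J A i) by rewrite /B; case: ifP.
exists (undup (J1 ++ J2)), (fun i => B J1 A1 i `&` B J2 A2 i); split.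
- exact: undup_uniq.
- by move=> i; rewrite mem_undup mem_cat => /orP[/J1D|/J2D].
- by move=> i; apply: GI; exact: GB.
apply/seteqP; split=> w.
  move=> [h1 h2] i _; split; rewrite /B; case: ifPn => //.
    exact: h1.
  exact: h2.
move=> h; split=> i /= iJ.
  have /h[+ _] : [set` undup (J1 ++ J2)] i by rewrite /= mem_undup mem_cat iJ.
  by rewrite /B iJ.
have /h[_ +] : [set` undup (J1 ++ J2)] i by rewrite /= mem_undup mem_cat iJ orbT.
by rewrite /B iJ.
Qed.

(** The sample space equipped with the sigma-algebra generated by the systems in
    [D]: being known from [D] becomes measurability of a map out of it. *)
Notation info D := (g_sigma_algebraType (cylinders D)).

Lemma info_sub D (C : set (info D)) : measurable C -> measurable (C : set Omega).
Proof.
apply: smallest_sub; last exact: cylinders_sub.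
exact: sigma_algebra_measurable.
Qed.

Lemma infoS (D D' : set I) (C : set Omega) : D `<=` D' ->
  measurable (C : set (info D)) -> measurable (C : set (info D')).
Proof. by move=> DD' mC; exact: (sub_sigma_algebra2 (cylindersS DD') mC). Qed.

(** For cylinders this is the product rule. Cylinders are stable under finite
    intersection, so the rule extends to the sigma-algebra they generate. *)
Lemma info_independent (D : set I) j (C B : set Omega) : ~ D j ->
  measurable (C : set (info D)) -> G j B -> P (C `&` B) = (P C * P B)%E.
Proof.
move=> Dj mC GB; have mB := mG GB.
have PBfin : P B \is a fin_num by exact: fin_num_measure.
have PB0 : 0 <= fine (P B) by rewrite fine_ge0.
pose m2 := mscale (NngNum PB0) P.
have m2E A : m2 A = (P A * P B)%E by rewrite /m2 /mscale /= fineK// muleC.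
rewrite -m2E.
rewrite -/(mrestr P mB C).
apply: (@g_sigma_algebra_measure_unique _ R Omega (cylinders D) _ (fun=> setT) _ _
    (mrestr P mB) m2 _ _ _ C mC) => //.
- exact: cylinders_sub.
- by move=> _; exact: cylindersT.
- by rewrite bigcup_const.
- exact: cylindersI.
- move=> _ [J [A [uJ JD GA ->]]]; apply: (etrans _ (esym (m2E _))).
  change (P ((\bigcap_(i in [set` J]) A i) `&` B) =
    (P (\bigcap_(i in [set` J]) A i) * P B)%E).
  pose A' i := if pselect (i = j) then B else A i.
  have jJ : j \notin J by apply/negP => /JD.
  have GA' i : G i (A' i) by rewrite /A'; case: pselect => /= [->|].
  have A'E i : i \in J -> A' i = A i.
    by rewrite /A'; case: pselect => /= [->|]; rewrite ?(negbTE jJ).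
  have A'j : A' j = B by rewrite /A'; case: pselect.
  have -> : (\bigcap_(i in [set` J]) A i) `&` B = \bigcap_(i in [set` j :: J]) A' i.
    apply/seteqP; split=> w.
      move=> [h Bw] i; rewrite /= inE => /orP[/eqP->|iJ]; first by rewrite A'j.
      by rewrite A'E//; exact: h.
    move=> h; split; last by rewrite -A'j; apply: h; rewrite /= mem_head.
    by move=> i iJ; rewrite -A'E//; apply: h; rewrite /= inE iJ orbT.
  rewrite !indG//; last by rewrite /= jJ.
  rewrite big_cons A'j muleC; congr (_ * _)%E.
  by rewrite big_seq [RHS]big_seq; apply: eq_bigr => i /A'E ->.
- move=> _; change (P (setT `&` B) < +oo)%E.
  by rewrite setTI (le_lt_trans (probability_le1 _ _)) ?ltry.
Qed.

(** The joint law of a random element known from the systems in [D] and one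
    generating a system outside [D] is a product. *)
Lemma ge0_integral_independent (D : set I) j d1 d2 (T1 : measurableType d1)
    (T2 : measurableType d2) (Y : Omega -> T1) (N : {RV P >-> T2})
    (f : T1 * T2 -> \bar R) : ~ D j ->
  measurable_fun [set: info D] (Y : info D -> T1) ->
  (forall B, measurable B -> G j (N @^-1` B)) ->
  measurable_fun [set: T1 * T2] f -> (forall z, (0 <= f z)%E) ->
  (\int[P]_w f (Y w, N w) = \int[P]_w \int[distribution P N]_v f (Y w, v))%E.
Proof.
move=> Dj mY GN mf f0.
have mYO : measurable_fun [set: Omega] Y.
  by move=> _ A mA; apply: info_sub; exact: mY.
pose Y' : {mfun Omega >-> T1} := HB.pack Y (isMeasurableFun.Build _ _ _ _ _ mYO).
have mN : measurable_fun [set: Omega] N by [].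
have mYN := measurable_fun_pair mYO mN.
pose YN : {mfun Omega >-> (T1 * T2)%type} :=
  HB.pack (fun w => (Y w, N w)) (isMeasurableFun.Build _ _ _ _ _ mYN).
transitivity (\int[distribution P YN]_z f z)%E.
  by rewrite [RHS]ge0_integral_pushforward.
transitivity (\int[(distribution P Y' \x distribution P N)%E]_z f z)%E.
  apply: eq_measure_integral => A mA _; apply/esym.
  apply: product_measure_unique => // B C mB mC.
  rewrite /distribution /pushforward /=.
  apply: (info_independent (D := D) (j := j)) => //; last exact: GN.
  by rewrite -[X in measurable X]setTI; exact: mY.
rewrite fubini_tonelli1// [LHS]ge0_integral_pushforward//.
- exact: measurable_fun_fubini_tonelli_F.
- by move=> x _; exact: integral_ge0.
Qed.

End Independence.

(** * The flow *)

Lemma measurable_fun_borel d (T : measurableType d) (X : ptopologicalType)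
    (f : T -> X) : (forall A, open A -> measurable (f @^-1` A)) ->
  measurable_fun [set: T] (f : T -> borel X).
Proof.
move=> h; apply: (@measurability _ _ T (borel X) setT f (@open X)) => //.
by move=> _ [A oA <-]; rewrite setTI; exact: h.
Qed.

Section Flow.
Context (R : realType) (disp : Order.disp_t) (S : POrderedPointedTopological.type disp).
Variables (Phi : S -> R -> S) (Phi_flow : continuous_semiflow Phi).

(** Replacing negative times by [0] makes the flow continuous, hence measurable,
    on the whole line. *)
Definition flow (x : S) (t : R) : S := Phi x (Num.max t 0).

Lemma flowE x t : 0 <= t -> flow x t = Phi x t.
Proof. by move=> t0; rewrite /flow max_l. Qed.

Lemma flow_add x s t : 0 <= s -> 0 <= t -> flow (flow x s) t = flow x (s + t).
Proof.
move=> s0 t0; rewrite !flowE ?addr_ge0//.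
by have [[_ h] _] := Phi_flow; exact: h.
Qed.

Lemma continuous_flow : continuous (fun z : S * R => flow z.1 z.2).
Proof.
have [_ /subspace_continuousP cPhi] := Phi_flow.
move=> [x t] A hA; set D := [set z : S * R | 0 <= z.2] in cPhi.
have Dc : D (x, Num.max t 0) by rewrite /D /= le_max lexx orbT.
have [[V W] /= [Vx Wt] VW] := cPhi _ Dc A hA.
have cmax : (fun s : R => Num.max s 0) @ t --> Num.max t 0.
  by apply: continuous_max; [exact: cvg_id|exact: cvg_cst].
exists (V, (fun s : R => Num.max s 0) @^-1` W) => /=.
  by split => //; exact: cmax.
move=> [y s] /= [Vy Ws]; apply: (VW (y, Num.max s 0)) => //=.
by rewrite /D /= le_max lexx orbT.
Qed.

Lemma measurable_flow : polish R S ->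
  measurable_fun [set: borel S * R] (fun z => flow z.1 z.2 : borel S).
Proof.
move=> pS; apply: measurable_fun_borel => A oA.
have [b cb] := polish_cbasis pS; have [b' cb'] := realType_cbasis R.
apply: (@measurable_open_prod _ _ (borel S) R S R id id b b' cb cb'
  (@open_borel S) (@open_measurable R) ((fun z : S * R => flow z.1 z.2) @^-1` A)).
by move: continuous_flow => /continuousP; apply.
Qed.

End Flow.

(** * Averaging over a shock and over a waiting time *)

Section ProbabilityIntegrals.
Context d (T : measurableType d) (R : realType) (p : probability T R).
Local Open Scope ereal_scope.

Lemma integral_probability_cst (r : \bar R) : \int[p]_x r = r.
Proof. by rewrite integral_cst//= probability_setT mule1. Qed.

Lemma ge0_integral_leD (f g : T -> \bar R) (r : \bar R) : 0 <= r ->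
  measurable_fun [set: T] f -> (forall x, 0 <= f x) ->
  measurable_fun [set: T] g -> (forall x, 0 <= g x) ->
  (forall x, f x <= g x + r) -> \int[p]_x f x <= \int[p]_x g x + r.
Proof.
move=> r0 mf f0 mg g0 fg.
rewrite -[X in _ + X](integral_probability_cst r) -ge0_integralD//.
apply: ge0_le_integral => //; exact: emeasurable_funD.
Qed.

Lemma integral_le1 (f : T -> \bar R) : measurable_fun [set: T] f ->
  (forall x, 0 <= f x) -> (forall x, f x <= 1) -> \int[p]_x f x <= 1.
Proof.
move=> mf f0 f1; rewrite -[leRHS](integral_probability_cst 1).
exact: ge0_le_integral.
Qed.

End ProbabilityIntegrals.

Section Operators.
Context (R : realType) (disp : Order.disp_t) (S : POrderedPointedTopological.type disp).
Context (polish_S : polish R S) (closed_le : closed_order S).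
Context (U : ptopologicalType).
Context (Phi : S -> R -> S) (Phi_flow : continuous_semiflow Phi).
Context (mu : probability (borel U) R) (nu : probability R R).
Context (F : S -> U -> S)
  (mF : measurable_fun [set: borel S * borel U]
          ((fun z => F z.1 z.2) : borel S * borel U -> borel S)).
Context (Phi_mono : forall t, 0 <= t -> order_preserving (Phi ^~ t))
  (F_mono : forall u, order_preserving (F ^~ u)).
Local Open Scope ereal_scope.

Local Notation flow := (flow Phi).

(** Nonnegative extended real values make every integral meaningful and give
    Tonelli's theorem without integrability conditions. *)
Definition unit_increasing (h : S -> \bar R) :=
  [/\ measurable_fun [set: borel S] (h : borel S -> \bar R), forall x, 0 <= h x,
      forall x, h x <= 1 & forall x y : S, (x <= y)%O -> h x <= h y].

Definition shock_avg (h : S -> \bar R) (x : S) : \bar R := \int[mu]_u h (F x u).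
Definition flow_avg (h : S -> \bar R) (x : S) : \bar R := \int[nu]_s h (flow x s).

Lemma measurable_flow_at t : measurable_fun [set: borel S] (flow ^~ t : borel S -> borel S).
Proof.
have m : measurable_fun [set: borel S] (fun x : borel S => (x, t)).
  exact: measurable_fun_pair.
exact: (measurableT_comp (measurable_flow Phi_flow polish_S) m).
Qed.

Lemma measurable_jump_at x : measurable_fun [set: borel U] (F x : borel U -> borel S).
Proof.
have m : measurable_fun [set: borel U] (fun u : borel U => (x : borel S, u)).
  exact: measurable_fun_pair.
exact: (measurableT_comp mF m).
Qed.

Lemma flow_mono t (x y : S) : (x <= y)%O -> (flow x t <= flow y t)%O.
Proof. by move=> xy; apply: Phi_mono => //; rewrite le_max lexx orbT. Qed.

Lemma unit_increasing_flow h t : unit_increasing h -> unit_increasing (h \o flow ^~ t).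
Proof.
move=> [mh h0 h1 hi]; split => //=.
- exact: (measurableT_comp mh (measurable_flow_at t)).
- by move=> x y xy; apply: hi; exact: flow_mono.
Qed.

Lemma measurable_jump_test h : unit_increasing h ->
  measurable_fun [set: borel S * borel U] (fun z => h (F z.1 z.2)).
Proof. by move=> [mh _ _ _]; exact: (measurableT_comp mh mF). Qed.

Lemma measurable_flow_test h : unit_increasing h ->
  measurable_fun [set: borel S * R] (fun z => h (flow z.1 z.2)).
Proof.
by move=> [mh _ _ _]; exact: (measurableT_comp mh (measurable_flow Phi_flow polish_S)).
Qed.

Lemma measurable_jump_test_at h x : unit_increasing h ->
  measurable_fun [set: borel U] (fun u => h (F x u)).
Proof. by move=> [mh _ _ _]; exact: (measurableT_comp mh (measurable_jump_at x)). Qed.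

Lemma measurable_flow_test_at h x : unit_increasing h ->
  measurable_fun [set: R] (fun s => h (flow x s)).
Proof.
move=> uh; have m : measurable_fun [set: R] (fun s : R => (x : borel S, s)).
  exact: measurable_fun_pair.
exact: (measurableT_comp (measurable_flow_test uh) m).
Qed.

Lemma unit_increasing_shock_avg h : unit_increasing h -> unit_increasing (shock_avg h).
Proof.
move=> uh; have [mh h0 h1 hi] := uh; split.
- exact: (measurable_fun_fubini_tonelli_F (m2 := mu) _ (measurable_jump_test uh)).
- by move=> x; exact: integral_ge0.
- by move=> x; apply: integral_le1 => //; exact: measurable_jump_test_at.
- move=> x y xy; apply: ge0_le_integral => //; try exact: measurable_jump_test_at.
  by move=> u _; apply: hi; exact: F_mono.
Qed.

Lemma unit_increasing_flow_avg h : unit_increasing h -> unit_increasing (flow_avg h).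
Proof.
move=> uh; have [mh h0 h1 hi] := uh; split.
- exact: (measurable_fun_fubini_tonelli_F (m2 := nu) _ (measurable_flow_test uh)).
- by move=> x; exact: integral_ge0.
- by move=> x; apply: integral_le1 => //; exact: measurable_flow_test_at.
- move=> x y xy; apply: ge0_le_integral => //; try exact: measurable_flow_test_at.
  by move=> s _; apply: hi; exact: flow_mono.
Qed.

(** In the renewal equation [r] is the age of the last jump: [h] is read after
    flowing for time [r] from the state that the shock produced. *)
Lemma measurable_shock_avg_flow h : unit_increasing h ->
  measurable_fun [set: R * borel S] (fun z => shock_avg (h \o flow ^~ z.1) z.2).
Proof.
move=> uh; have [mh h0 h1 hi] := uh.
apply: (measurable_fun_fubini_tonelli_F (m2 := mu)
  (fun z : (R * borel S) * borel U => h (flow (F z.1.2 z.2) z.1.1))) => [|z]; last exact: h0.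
have m1 : measurable_fun [set: (R * borel S) * borel U]
    (fun z => (z.1.2 : borel S, z.2 : borel U)).
  apply: measurable_fun_pair => //; exact: (measurableT_comp measurable_snd measurable_fst).
have m2 := measurableT_comp mF m1.
have m3 : measurable_fun [set: (R * borel S) * borel U]
    (fun z => (F z.1.2 z.2 : borel S, z.1.1 : R)).
  apply: measurable_fun_pair => //; exact: (measurableT_comp measurable_fst measurable_fst).
exact: (measurableT_comp (measurable_flow_test uh) m3).
Qed.

Context (f1 f2 : borel U -> borel S).
Context (mf1 : measurable_fun [set: borel U] f1) (mf2 : measurable_fun [set: borel U] f2).
Context (F_bounds : forall x : S,
  {ae mu, forall u, ((f1 u : S) <= F x u)%O /\ (F x u <= (f2 u : S))%O}).

Let M : set (borel U * borel U) := [set p | ((f2 p.1 : S) <= (f1 p.2 : S))%O].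

Lemma measurable_swap_set : measurable M.
Proof.
have [_ [dist [dm dS _]]] := polish_S; have [b cb] := polish_cbasis polish_S.
apply: (measurable_le dS closed_le cb).
- exact: (measurableT_comp mf2 measurable_fst).
- exact: (measurableT_comp mf1 measurable_snd).
Qed.

(** Let the shock [u] hit [x] and an independent [v] hit [y]. On [M], which has
    probability at least [p], [F x u <= f2 u <= f1 v <= F y v], so that
    [h (F x u) <= h (F y v)]; elsewhere the two values differ by at most [dl]. *)
Lemma shock_avg_contraction (p dl : R) (h : S -> \bar R) :
  (0 <= p)%R -> (0 <= dl)%R ->
  p%:E <= (mu \x mu) M -> unit_increasing h -> (forall x y, h x <= h y + dl%:E) ->
  forall x y, shock_avg h x <= shock_avg h y + ((1 - p) * dl)%:E.
Proof.
move=> p0 dl0 pM uh hdl x y; have [mh h0 h1 hi] := uh.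
have mM := measurable_swap_set.
pose g (z : borel U * borel U) : \bar R := h (F y z.2) + (dl * \1_(~` M) z)%:E.
have mg2 : measurable_fun [set: borel U * borel U] (fun z => (dl * \1_(~` M) z)%:E).
  apply/measurable_EFinP; apply: measurable_funM => //.
  by apply: measurable_indic; exact: measurableC.
have mgy : measurable_fun [set: borel U * borel U] (fun z => h (F y z.2)).
  exact: (measurableT_comp (measurable_jump_test_at y uh) measurable_snd).
have mg : measurable_fun [set: borel U * borel U] g by exact: emeasurable_funD.
have ind0 z : 0 <= (dl * \1_(~` M) z)%:E :> \bar R by rewrite lee_fin mulr_ge0.
have g0 z : 0 <= g z by rewrite adde_ge0.
have mgu u : measurable_fun [set: borel U] (fun v => g (u, v)).
  by apply: (measurableT_comp mg); exact: measurable_fun_pair.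
apply: (@le_trans _ _ (\int[mu]_u \int[mu]_v g (u, v))).
  apply: ae_ge0_le_integral => //.
  - exact: measurable_jump_test_at.
  - by move=> u _; apply: integral_ge0.
  - exact: (measurable_fun_fubini_tonelli_F (m2 := mu) _ mg).
  have := F_bounds x; apply: filterS => u [_ xu] _.
  rewrite -[leLHS](integral_probability_cst mu).
  apply: ae_ge0_le_integral => //.
  have := F_bounds y; apply: filterS => v [yv _] _; rewrite /g /= indicE.
  have [/set_mem Muv|Muv] := boolP ((u, v) \in M).
    rewrite memNset /= ?mulr0 ?adde0; last by move=> /(_ Muv).
    by apply: hi; apply: le_trans xu _; apply: le_trans Muv _.
  by rewrite mem_set ?mulr1; [exact: hdl|move/mem_set; exact/negP].
rewrite -(fubini_tonelli1 (m1 := mu) (m2 := mu))//.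
rewrite ge0_integralD//; apply: leeD.
  rewrite fubini_tonelli1//= /fubini_F /= integral_probability_cst.
  exact: lexx.
under eq_integral do rewrite EFinM.
rewrite ge0_integralZl_EFin//; last first.
  by apply/measurable_EFinP; apply: measurable_indic; exact: measurableC.
rewrite integral_indic ?setIT//; last exact: measurableC.
have mT : (mu \x mu) setT = 1.
  by rewrite -setXTT product_measure1E//= !probability_setT mule1.
have MC : (mu \x mu) M + (mu \x mu) (~` M) = 1.
  rewrite -mT -(setUv M) measureU//; first exact: measurableC.
  by rewrite setICr.
have /fineK MCfin : (mu \x mu) (~` M) \is a fin_num.
  rewrite ge0_fin_numE//; apply: (le_lt_trans _ (ltry 1)); rewrite -MC.
  exact: leeDr.
rewrite [X in dl%:E * X](_ : _ = (fine ((mu \x mu) (~` M)))%:E); last exact/esym.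
rewrite -EFinM lee_fin mulrC; apply: ler_wpM2r => //.
by rewrite lerBrDl -lee_fin EFinD MCfin -MC leeD2r.
Qed.

(** By invariance [phi] averages [k] as a jump followed by an exponential flow
    time does. Splitting that time at [t] by memorylessness produces, from the
    part beyond [t], the average of [h (flow x t)]: the renewal equation of the
    process, with [phi] in place of the law before the last jump. *)
Lemma prejump_invariant_renewal (phi : probability (borel S) R) (h : S -> \bar R) (c t : R) :
  (0 < c)%R -> (forall A, measurable A -> nu A = exponential_prob c A) -> (0 <= t)%R ->
  (forall k, unit_increasing k -> \int[phi]_x shock_avg (flow_avg k) x = \int[phi]_x k x) ->
  unit_increasing h ->
  \int[phi]_x h x = (survival c t)%:E * \int[phi]_x h (flow x t) +
    \int[nu]_r (((0 <= t - r)%R%:R : R)%:E * \int[phi]_x shock_avg (h \o flow ^~ r) x).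
Proof.
move=> c0 nuE t0 inv uh.
pose q (k : S -> \bar R) r := \int[phi]_x shock_avg (k \o flow ^~ r) x.
have mq k : unit_increasing k -> measurable_fun [set: R] (q k).
  move=> uk; apply: (measurable_fun_fubini_tonelli_F (m2 := phi) _ (measurable_shock_avg_flow uk)).
  by move=> z; apply: integral_ge0 => u _ /=; have [_ + _ _] := uk; apply.
have q0 k r : unit_increasing k -> 0 <= q k r.
  by move=> [_ k0 _ _]; apply: integral_ge0 => x _; apply: integral_ge0 => u _; exact: k0.
(* Invariance and Tonelli: the [phi]-average of [k] is the average of [q k]
   over an exponential age. *)
have qE k : unit_increasing k -> \int[phi]_x k x = \int[nu]_r q k r.
  move=> uk; have [mk k0 k1 ki] := uk; rewrite -inv//.
  rewrite (_ : \int[nu]_r q k r = \int[phi]_x \int[nu]_r shock_avg (k \o flow ^~ r) x); last first.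
    apply: (fubini_tonelli (m1 := nu) (m2 := phi)
      (fun z : R * borel S => shock_avg (k \o flow ^~ z.1) z.2)).
    - exact: measurable_shock_avg_flow.
    - by move=> z; apply: integral_ge0 => u _; exact: k0.
  apply: eq_integral => x _.
  apply: (fubini_tonelli (m1 := mu) (m2 := nu)
    (fun z : borel U * R => k (flow (F x z.1) z.2))) => [|z]; last exact: k0.
  have m : measurable_fun [set: borel U * R] (fun z => (F x z.1 : borel S, z.2 : R)).
    apply: measurable_fun_pair => //.
    exact: (measurableT_comp (measurable_jump_at x) measurable_fst).
  exact: (measurableT_comp (measurable_flow_test uk) m).
rewrite qE// (memoryless c0 nuE t0); last 2 first.
- exact: mq.
- by move=> r; exact: q0.
rewrite addeC; congr (_ * _ + _).
have uht := unit_increasing_flow t uh.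
rewrite [RHS](qE _ uht); apply: ge0_ae_eq_integral => //.
- have mD : measurable_fun [set: R] (fun x : R => t + x)%R by exact: measurable_funD.
  exact: (measurableT_comp (mq _ uh) mD).
- exact: mq.
- by move=> r _; exact: q0.
- by move=> r _; exact: q0.
exists [set r | r < 0]%R; split.
- by rewrite -[X in measurable X]set_itvNyo; exact: measurable_itv.
- exact: (exponential_lt0 nuE).
move=> r /= hr; rewrite ltNge; apply/negP => r0; apply: hr => _.
apply: eq_integral => x _; apply: eq_integral => u _ /=.
by rewrite flow_add// addrC.
Qed.

End Operators.

(** * Independence and law of the noise of the process *)

Section Noise.
Context (R : realType) (S U : ptopologicalType) (lambda : R) (mu : probability (borel U) R).
Context d (Omega : measurableType d) (P : probability Omega R).
Context (E : nat -> {RV P >-> R}) (xi : nat -> {RV P >-> borel U}).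
Hypothesis noise : pdmp_noise E xi lambda mu.

Local Notation G := (noise_sigma_algebra E xi).
Notation info D := (g_sigma_algebraType (cylinders G D)).

Let indG : mutually_independent P G. Proof. by have [] := noise. Qed.

Let mG i : G i `<=` measurable.
Proof.
case: i => n _ [A mA <-]; rewrite setTI /=.
  by rewrite -[X in measurable X]setTI; exact: (measurable_funPT (E n)).
by rewrite -[X in measurable X]setTI; exact: (measurable_funPT (xi n)).
Qed.

Let GT i : G i setT.
Proof. by case: i => n; exists setT => //; rewrite setTI. Qed.

Let GI i : setI_closed (G i).
Proof.
case: i => n _ _ [A mA <-] [B mB <-]; exists (A `&` B);
  by [exact: measurableI|rewrite !setTI].
Qed.

Lemma info_measurable d1 (T1 : measurableType d1) D (Y : Omega -> T1) :
  measurable_fun [set: info D] (Y : info D -> T1) -> measurable_fun [set: Omega] Y.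
Proof. by move=> mY _ A mA; apply: (info_sub mG); exact: mY. Qed.

Lemma info_weaken d1 (T1 : measurableType d1) (D D' : set (nat + nat)) (Y : Omega -> T1) :
  D `<=` D' -> measurable_fun [set: info D] (Y : info D -> T1) ->
  measurable_fun [set: info D'] (Y : info D' -> T1).
Proof. by move=> DD' mY _ A mA; apply: (infoS DD'); exact: mY. Qed.

Lemma info_wait (D : set (nat + nat)) n : D (inl n) ->
  measurable_fun [set: info D] (E n : info D -> R).
Proof.
move=> Dn _ A mA; apply: sub_sigma_algebra; apply: sub_cylinders Dn _ => //.
by exists A.
Qed.

Lemma info_shock (D : set (nat + nat)) n : D (inr n) ->
  measurable_fun [set: info D] (xi n : info D -> borel U).
Proof.
move=> Dn _ A mA; apply: sub_sigma_algebra; apply: sub_cylinders Dn _ => //.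
by exists A.
Qed.

Local Open Scope ereal_scope.
Local Notation nu := (distribution P (E 0%N)).

Lemma wait_lawE A : measurable A -> nu A = exponential_prob lambda A.
Proof. by have [_ h _ _] := noise; exact: h. Qed.

Lemma integral_next_wait d1 (T1 : measurableType d1) (D : set (nat + nat)) n
    (Y : Omega -> T1) (f : T1 * R -> \bar R) : ~ D (inl n) ->
  measurable_fun [set: info D] (Y : info D -> T1) ->
  measurable_fun [set: T1 * R] f -> (forall z, 0 <= f z) ->
  \int[P]_w f (Y w, E n w) = \int[P]_w \int[nu]_s f (Y w, s).
Proof.
move=> Dn mY mf f0.
rewrite (ge0_integral_independent indG mG GT GI Dn mY)//; last first.
  by move=> B mB; exists B => //; rewrite setTI.
apply: eq_integral => w _; apply: eq_measure_integral => A mA _.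
by have [_ h _ _] := noise; rewrite /= !h.
Qed.

Lemma integral_next_shock d1 (T1 : measurableType d1) (D : set (nat + nat)) n
    (Y : Omega -> T1) (f : T1 * borel U -> \bar R) : ~ D (inr n) ->
  measurable_fun [set: info D] (Y : info D -> T1) ->
  measurable_fun [set: T1 * borel U] f -> (forall z, 0 <= f z) ->
  \int[P]_w f (Y w, xi n w) = \int[P]_w \int[mu]_u f (Y w, u).
Proof.
move=> Dn mY mf f0.
rewrite (ge0_integral_independent indG mG GT GI Dn mY)//; last first.
  by move=> B mB; exists B => //; rewrite setTI.
apply: eq_integral => w _; apply: eq_measure_integral => A mA _.
by have [_ _ h _] := noise; rewrite /= h.
Qed.

(** [T_n <= t] forces each of the first [n] waiting times to be at most [t]. *)
Lemma many_jumps_unlikely n t : (0 < lambda)%R -> (0 <= t)%R ->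
  P [set w | (jump_time (E ^~ w) n <= t)%R] <= ((1 - survival lambda t) ^+ n)%:E.
Proof.
move=> l0 t0.
have mC k : measurable (E k @^-1` [set x | x <= t]%R).
  rewrite -[X in measurable X]setTI; apply: (measurable_funPT (E k)) => //.
  by rewrite -set_itvNyc; exact: measurable_itv.
pose A (i : nat + nat) := if i is inl k then E k @^-1` [set x | x <= t]%R else setT.
pose J : seq (nat + nat) := [seq inl k | k <- iota 0 n].
apply: (@le_trans _ _ (P (\bigcap_(i in [set` J]) A i))).
  apply: le_measure.
  - apply/mem_set.
    rewrite (_ : [set _ | _] = (fun w => jump_time (E ^~ w) n) @^-1` `]-oo, t]%classic); last first.
      by rewrite set_itvNyc.
    rewrite -[X in measurable X]setTI.
    by apply: measurable_sum => // i; exact: (measurable_funPT (E i)).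
  - apply/mem_set; apply: fin_bigcap_measurable => // i /= /mapP[k _ ->]; exact: mC.
  move=> w /= Tn i /mapP[k]; rewrite mem_iota add0n => /andP[_ kn] -> /=.
  apply: le_trans Tn; rewrite /jump_time (bigD1 (Ordinal kn))//= lerDl.
  by apply: sumr_ge0 => j _; have [h _ _ _] := noise; exact: h.
rewrite indG//; last 2 first.
- by rewrite map_inj_uniq ?iota_uniq// => ? ? [].
- move=> _ /mapP[k _ ->]; exists [set x | x <= t]%R; last by rewrite setTI.
  by rewrite -set_itvNyc; exact: measurable_itv.
rewrite big_map (eq_bigr (fun=> (1 - survival lambda t)%:E)); last first.
  move=> k _ /=; have [_ hE _ _] := noise.
  have mt : measurable [set x : R | x <= t]%R.
    by rewrite -set_itvNyc; exact: measurable_itv.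
  transitivity (nu [set x | x <= t]%R); first exact: etrans (hE _ _ mt) (esym (hE _ _ mt)).
  rewrite EFinB -(exponential_gt l0 wait_lawE t0) -probability_setC; last first.
    by rewrite -set_itvoy; exact: measurable_itv.
  by congr (P _); apply/seteqP; split=> w /=; rewrite leNgt => /negP.
rewrite le_eqVlt; apply/orP; left; apply/eqP.
elim: n {J} => [|n IH]; first by rewrite big_nil expr0.
by rewrite -[n.+1]addn1 iotaD big_cat/= IH big_seq1 -EFinM addn1 exprSr.
Qed.

End Noise.

(** * Reading the noise backwards: a law invariant before jumps *)

(** The limit lies in an open set exactly when, for some [k], the maps are
    eventually at distance at least [1/(k+1)] from its complement. *)
Lemma measurable_fun_cvg_borel (R : realType) d (T : measurableType d)
    (X : ptopologicalType) (dist : X -> X -> R) (f : nat -> T -> X) (g : T -> X) :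
  metric dist -> induces_topology dist ->
  (forall n, measurable_fun [set: T] (f n : T -> borel X)) ->
  (forall w, f n w @[n --> \oo] --> g w) ->
  measurable_fun [set: T] (g : T -> borel X).
Proof.
move=> dm dT mf fg; apply: measurable_fun_borel => A oA.
rewrite (_ : g @^-1` A =
    \bigcup_k \bigcup_N \bigcap_(n in [set n | (N <= n)%N]) (f n @^-1` deep dist A k)).
  apply: bigcupT_measurable => k; apply: bigcupT_measurable => N.
  apply: bigcap_measurableType => n _.
  rewrite -[X in measurable X]setTI; apply: mf => //.
  by apply: closed_borel; exact: closed_deep.
apply/seteqP; split=> [w Aw|w [k _ [N _ h]]].
  have [e e0 eA] : exists2 e, 0 < e & forall y, dist (g w) y < e -> A y.
    by apply: (ball_of_nbhs dT); exact: open_nbhs_nbhs.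
  have [k ke] := @exists_invS_lt R (e / 2) (divr_gt0 e0 (ltr0n _ 2)).
  have k0 : 0 < k.+1%:R^-1 :> R by rewrite invr_gt0.
  have /(cvg_distP dT)/(_ _ k0)[N hN] := fg w.
  exists k => //; exists N => // n /= Nn y fy; apply: eA.
  move: (hN n Nn) fy ke; set r := _^-1; have := dist_triangle dm (f n w) (g w) y.
  by lra.
rewrite (open_bigcup_deep dm dT oA); exists k => //.
have cD : closed (deep dist A k) by exact: closed_deep.
apply: (closed_cvg _ cD _ _ (fg w)).
by exists N => // n /= Nn; exact: h.
Qed.

Section Backward.
Context (R : realType) (disp : Order.disp_t) (S : POrderedPointedTopological.type disp).
Context (polish_S : polish R S) (closed_le : closed_order S).
Context (compactE : forall A : set S, compact A <-> closed A /\ order_bounded A).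
Context (U : ptopologicalType).
Context (Phi : S -> R -> S) (Phi_flow : continuous_semiflow Phi).
Context (lambda : R) (mu : probability (borel U) R).
Context (F : S -> U -> S)
  (mF : measurable_fun [set: borel S * borel U]
          ((fun z => F z.1 z.2) : borel S * borel U -> borel S)).
Context d (Omega : measurableType d) (P : probability Omega R).
Context (E : nat -> {RV P >-> R}) (xi : nat -> {RV P >-> borel U}).
Context (noise : pdmp_noise E xi lambda mu).
Context (Phi_mono : forall t, 0 <= t -> order_preserving (Phi ^~ t))
  (F_mono : forall u, order_preserving (F ^~ u)).
Context (f1 f2 : borel U -> borel S).
Context (mf1 : measurable_fun [set: borel U] f1) (mf2 : measurable_fun [set: borel U] f2).
Context (F_bounds : forall x : S,
  {ae mu, forall u, ((f1 u : S) <= F x u)%O /\ (F x u <= (f2 u : S))%O}).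

Local Notation G := (noise_sigma_algebra E xi).
Notation info D := (g_sigma_algebraType (cylinders G D)).
Local Notation flow := (flow Phi).
Local Notation nu := (distribution P (E 0%N)).
Local Open Scope ereal_scope.

(** [back g n m w]: the state just before a jump when the noise is read towards
    the past, [m] being the most recent index, and [g] was applied to the shock
    numbered [n + m]. *)
Fixpoint back (g : borel U -> borel S) (n m : nat) (w : Omega) : S :=
  if n is n'.+1 then flow (F (back g n' m.+1 w) (xi m w)) (E m w)
  else flow (g (xi m w)) (E m w).

Definition from (m : nat) : set (nat + nat) :=
  [set i | match i with inl k | inr k => (m <= k)%N end].

Lemma measurable_back g n m : measurable_fun [set: borel U] g ->
  measurable_fun [set: info (from m)] (back g n m : info (from m) -> borel S).
Proof.
move=> mg; elim: n m => [|n IH] m /=.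
  have mE : measurable_fun [set: info (from m)] (E m : info (from m) -> R).
    by apply: info_wait; rewrite /from /=.
  have mx : measurable_fun [set: info (from m)] (xi m : info (from m) -> borel U).
    by apply: info_shock; rewrite /from /=.
  have mp := measurable_fun_pair (measurableT_comp mg mx) mE.
  exact: (measurableT_comp (measurable_flow Phi_flow polish_S) mp).
have mE : measurable_fun [set: info (from m)] (E m : info (from m) -> R).
  by apply: info_wait; rewrite /from /=.
have mx : measurable_fun [set: info (from m)] (xi m : info (from m) -> borel U).
  by apply: info_shock; rewrite /from /=.
have mb : measurable_fun [set: info (from m)] (back g n m.+1 : info (from m) -> borel S).
  by apply: info_weaken (IH m.+1) => -[] k /= /ltnW.
have mz := measurableT_comp mF (measurable_fun_pair mb mx).
have mp := measurable_fun_pair mz mE.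
exact: (measurableT_comp (measurable_flow Phi_flow polish_S) mp).
Qed.

Local Notation shock_avg := (shock_avg mu F).
Local Notation flow_avg := (flow_avg Phi nu).
Local Notation ui := (@unit_increasing R disp S).

Definition prejump_avg (h : S -> \bar R) : S -> \bar R := shock_avg (flow_avg h).

Lemma unit_increasing_prejump_avg h : ui h -> ui (prejump_avg h).
Proof.
by move=> uh; apply: unit_increasing_shock_avg => //; exact: unit_increasing_flow_avg.
Qed.

Let before m : set (nat + nat) := [set i | from m i /\ i <> inl m].

(** Each step of [back] uses fresh noise, independent of the deeper steps, so
    averaging it out from the most recent index on iterates the transition
    operator of the chain. *)
Lemma integral_back g n m h : measurable_fun [set: borel U] g -> ui h ->
  \int[P]_w h (back g n m w) = \int[mu]_u flow_avg (iter n prejump_avg h) (g u).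
Proof.
move=> mg; elim: n m h => [|n IH] m h uh /=.
  have [mh h0 _ _] := uh; have [mv v0 _ _] := unit_increasing_flow_avg polish_S Phi_flow nu Phi_mono uh.
  have mx : measurable_fun [set: info (before m)] (xi m : info (before m) -> borel U).
    by apply: info_shock; split => //; rewrite /from /=.
  rewrite (integral_next_wait noise (T1 := borel S) (D := before m)
    (f := fun z : borel S * R => h (flow z.1 z.2)) (n := m) (Y := g \o xi m)); last 4 first.
  - by case.
  - exact: (measurableT_comp mg mx).
  - exact: measurable_flow_test.
  - by move=> z; exact: h0.
  have e : measurable_fun [set: info set0] (fun _ : info set0 => tt) by exact: measurable_cst.
  rewrite -[LHS]/(\int[P]_w (flow_avg h \o g) (xi m w)).
  rewrite (integral_next_shock noise (D := set0) (Y := fun=> tt) (n := m)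
     (f := fun z : unit * borel U => flow_avg h (g z.2))) => //.
  - by rewrite integral_probability_cst.
  - exact: (measurableT_comp mv (measurableT_comp mg measurable_snd)).
have [mh h0 _ _] := uh; have uv := unit_increasing_flow_avg polish_S Phi_flow nu Phi_mono uh.
have [mv v0 _ _] := uv.
have mx : measurable_fun [set: info (before m)] (xi m : info (before m) -> borel U).
  by apply: info_shock; split => //; rewrite /from /=.
have mb := @measurable_back g n m.+1 mg.
have mb' : measurable_fun [set: info (before m)] (back g n m.+1 : info (before m) -> borel S).
  apply: info_weaken mb => -[] k /= mk; split=> //; rewrite /from /=; try exact: ltnW.
  by case=> km; rewrite km ltnn in mk.
rewrite (integral_next_wait noise (T1 := borel S) (D := before m)
    (f := fun z : borel S * R => h (flow z.1 z.2)) (n := m)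
    (Y := fun w => F (back g n m.+1 w) (xi m w))); last 4 first.
- by case.
- exact: (measurableT_comp mF (measurable_fun_pair mb' mx)).
- exact: measurable_flow_test.
- by move=> z; exact: h0.
rewrite (integral_next_shock noise (T1 := borel S) (D := from m.+1) (Y := back g n m.+1) (n := m)
     (f := fun z : borel S * borel U => flow_avg h (F z.1 z.2))) => //.
- rewrite -[LHS]/(\int[P]_w prejump_avg h (back g n m.+1 w)) IH -?iterSr//.
  exact: unit_increasing_prejump_avg.
- by rewrite /from /= ltnn.
- exact: measurable_jump_test.
Qed.

Let measurable_le_at d1 (T1 : measurableType d1) (f g : T1 -> borel S) :
  measurable_fun [set: T1] f -> measurable_fun [set: T1] g ->
  measurable [set w | ((f w : S) <= g w)%O].
Proof.
have [_ [dist [dm dS _]]] := polish_S; have [b cb] := polish_cbasis polish_S.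
exact: (measurable_le dS closed_le cb).
Qed.

(** The almost sure bounds on [F] survive substituting a random state that is
    independent of the shock. *)
Lemma ae_jump_bounds m (Y : Omega -> S) :
  measurable_fun [set: info (from m.+1)] (Y : info (from m.+1) -> borel S) ->
  {ae P, forall w, ((f1 (xi m w) : S) <= F (Y w) (xi m w))%O /\
                   (F (Y w) (xi m w) <= (f2 (xi m w) : S))%O}.
Proof.
move=> mY.
pose B : set (borel S * borel U) := ~` ([set z | ((f1 z.2 : S) <= F z.1 z.2)%O] `&`
  [set z | (F z.1 z.2 <= (f2 z.2 : S))%O]).
have mB : measurable B.
  apply: measurableC; apply: measurableI; apply: measurable_le_at => //.
  - exact: (measurableT_comp mf1 measurable_snd).
  - exact: (measurableT_comp mf2 measurable_snd).
have m1B : measurable_fun [set: borel S * borel U] (fun z => (\1_B z)%:E : \bar R).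
  by apply/measurable_EFinP; exact: measurable_indic.
have mYO := info_measurable mY.
have mYx : measurable_fun [set: Omega] (fun w => (Y w : borel S, xi m w : borel U)).
  by apply: measurable_fun_pair => //; exact: (measurable_funPT (xi m)).
have mBw : measurable [set w | B (Y w, xi m w)].
  by rewrite -[X in measurable X]setTI; exact: mYx.
exists [set w | B (Y w, xi m w)]; split => //.
rewrite -[X in P X]setIT -integral_indic//.
rewrite (_ : \int[P]_w _ = \int[P]_w (\1_B (Y w, xi m w))%:E)//.
rewrite (integral_next_shock noise (T1 := borel S) (D := from m.+1) (Y := Y) (n := m)
   (f := fun z : borel S * borel U => (\1_B z)%:E : \bar R)) => //; last 1 first.
- by rewrite /from /= ltnn.
apply: integral0_eq => w _.
rewrite (_ : 0 = \int[mu]_u (cst 0 u)); last by rewrite integral0.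
apply: ge0_ae_eq_integral => //.
  by apply: (measurableT_comp m1B); exact: measurable_fun_pair.
have := F_bounds (Y w); apply: filterS => u h _ /=.
by rewrite indicE memNset//= => /(_ h).
Qed.

Let back_mono g g' n m w : (forall k, ((g (xi k w) : S) <= g' (xi k w))%O) ->
  (back g n m w <= back g' n m w)%O.
Proof.
move=> gg'; elim: n m => [|n IH] m /=; first exact: flow_mono.
by apply: flow_mono => //; exact: F_mono.
Qed.

Let back_S_ge g n m w :
  (forall k, ((g (xi k w) : S) <= F (back g 0 k.+1 w) (xi k w))%O) ->
  (back g n m w <= back g n.+1 m w)%O.
Proof.
move=> h; elim: n m => [|n IH] m; first by apply: flow_mono => //; exact: h.
by apply: flow_mono => //; apply: F_mono; exact: IH.
Qed.

Let back_S_le g n m w :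
  (forall k, (F (back g 0 k.+1 w) (xi k w) <= (g (xi k w) : S))%O) ->
  (back g n.+1 m w <= back g n m w)%O.
Proof.
move=> h; elim: n m => [|n IH] m; first by apply: flow_mono => //; exact: h.
by apply: flow_mono => //; apply: F_mono; exact: IH.
Qed.

(** Reading the noise towards the past, the states started from the lower bound
    increase and those started from the upper bound decrease. Both stay in the
    order interval between the first two, which is compact. *)
Lemma back_limit : exists L : {mfun Omega >-> borel S},
  {ae P, forall w, forall n, ((back f1 n 0 w : S) <= L w)%O /\
     ((L w : S) <= back f2 n 0 w)%O}.
Proof.
have [_ [dist [dm dS _]]] := polish_S.
have : {ae P, forall w, forall k,
    [/\ ((f1 (xi k w) : S) <= F (back f1 0 k.+1 w) (xi k w))%O,
     (F (back f2 0 k.+1 w) (xi k w) <= (f2 (xi k w) : S))%O &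
     ((f1 (xi k w) : S) <= f2 (xi k w))%O]}.
  apply: ae_foralln => k.
  have h1 := ae_jump_bounds (@measurable_back f1 0 k.+1 mf1).
  have h2 := ae_jump_bounds (@measurable_back f2 0 k.+1 mf2).
  by apply: filterS2 h1 h2 => w [a1 a2] [b1 b2]; split => //; exact: le_trans b2.
move=> [N [mN PN hN]].
have gd w : ~ N w -> forall k,
    [/\ ((f1 (xi k w) : S) <= F (back f1 0 k.+1 w) (xi k w))%O,
     (F (back f2 0 k.+1 w) (xi k w) <= (f2 (xi k w) : S))%O &
     ((f1 (xi k w) : S) <= f2 (xi k w))%O].
  by move=> Nw; apply: contrapT => h; apply: Nw; exact: hN.
have /choice[L hL] : forall w, exists l : S, if pselect (N w) then l = point else
    back f1 n 0 w @[n --> \oo] --> l /\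
    forall n, (back f1 n 0 w <= l)%O /\ (l <= back f2 n 0 w)%O.
  move=> w; case: pselect => Nw /=; first by exists point.
  have g1 n m : (back f1 n m w <= back f1 n.+1 m w)%O.
    by apply: back_S_ge => k; have [] := gd w Nw k.
  have g2 n m : (back f2 n.+1 m w <= back f2 n m w)%O.
    by apply: back_S_le => k; have [] := gd w Nw k.
  have g12 n m : (back f1 n m w <= back f2 n m w)%O.
    by apply: back_mono => k; have [] := gd w Nw k.
  have g1' n k : (n <= k)%N -> (back f1 n 0 w <= back f1 k 0 w)%O.
    by move=> /subnK <-; elim: (k - n)%N => // j IH; rewrite addSn (le_trans IH).
  have g2' n k : (n <= k)%N -> (back f2 k 0 w <= back f2 n 0 w)%O.
    by move=> /subnK <-; elim: (k - n)%N => // j IH; rewrite addSn (le_trans _ IH).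
  have g12' n k : (back f1 n 0 w <= back f2 k 0 w)%O.
    have [nk|/ltnW kn] := leqP n k; first exact: le_trans (g1' _ _ nk) (g12 _ _).
    exact: le_trans (g12 _ _) (g2' _ _ kn).
  have cI : compact (order_interval (back f1 0 0 w) (back f2 0 0 w)).
    apply/compactE; split; first exact: (closed_order_interval dm dS closed_le).
    by exists (back f1 0 0 w), (back f2 0 0 w); split.
  have [||l ul lb] := nondecreasing_compact_cvg (u := fun n => back f1 n 0 w) dm dS closed_le cI.
  - by move=> n; exact: g1.
  - by move=> n; apply/andP; split; [exact: g1'|exact: g12'].
  exists l; split => // n; split => //.
  have cd : closed [set x : S | (x <= back f2 n 0 w)%O] by exact: (closed_downset dm dS closed_le).
  apply: (closed_cvg _ cd _ _ ul).
  by exists 0%N => // k _ /=; exact: g12'.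
pose X n w : S := if pselect (N w) then point else back f1 n 0 w.
have mX n : measurable_fun [set: Omega] (X n : Omega -> borel S).
  move=> _ A mA; rewrite setTI.
  rewrite (_ : X n @^-1` A = (N `&` [set w | A point]) `|` (~` N `&` back f1 n 0 @^-1` A)).
    apply: measurableU; apply: measurableI => //.
    - have [Ap|nAp] := pselect (A point); first by rewrite (_ : [set _ | _] = setT)// -subTset.
      by rewrite (_ : [set _ | _] = set0)// -subset0.
    - exact: measurableC.
    - rewrite -[X in measurable X]setTI.
      exact: (info_measurable (@measurable_back f1 n 0 mf1)).
  by apply/seteqP; split=> w; rewrite /X /=; case: pselect => Nw;
    [left|right|case=> -[]|case=> -[]].
have mL : measurable_fun [set: Omega] (L : Omega -> borel S).
  apply: (measurable_fun_cvg_borel dm dS mX) => w; rewrite /X.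
  have := hL w; case: pselect => Nw /=; last by case.
  by move=> ->; exact: cvg_cst.
pose L' : {mfun Omega >-> borel S} :=
  HB.pack (L : Omega -> borel S) (isMeasurableFun.Build _ _ _ _ _ mL).
exists L'.
exists N; split => // w /= h; apply: contrapT => Nw; apply: h => n /=.
by have := hL w; case: pselect => // _ [_]; apply.
Qed.

(** The oscillation of a test function is at most [1]; each jump multiplies it by
    [1 - p] and each flow does not increase it. *)
Lemma iter_prejump_avg_osc (p : R) (h : S -> \bar R) n : (0 <= p <= 1)%R ->
  p%:E <= (mu \x mu) [set q | ((f2 q.1 : S) <= (f1 q.2 : S))%O] -> ui h ->
  ui (iter n prejump_avg h) /\
  forall x y, iter n prejump_avg h x <= iter n prejump_avg h y + ((1 - p) ^+ n)%:E.
Proof.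
move=> /andP[p0 p1] pM uh; elim: n => [|n [uIH IH]] /=.
  split=> // x y; have [_ h0 h1 _] := uh; rewrite expr0.
  by apply: le_trans (h1 x) _; exact: leeDr.
split; first exact: unit_increasing_prejump_avg.
have uV := unit_increasing_flow_avg polish_S Phi_flow nu Phi_mono uIH.
have q0 : (0 <= (1 - p) ^+ n)%R by rewrite exprn_ge0// subr_ge0.
have oV x y : flow_avg (iter n prejump_avg h) x <=
    flow_avg (iter n prejump_avg h) y + ((1 - p) ^+ n)%:E.
  have [_ v0 _ _] := uIH.
  apply: ge0_integral_leD => //; try exact: measurable_flow_test_at.
move=> x y; rewrite exprS.
exact: (shock_avg_contraction polish_S closed_le mF mf1 mf2 F_bounds p0 q0 pM uV oV).
Qed.

Lemma prejump_avg_le h (a : \bar R) : ui h -> 0 <= a -> (forall x, h x <= a) ->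
  forall x, flow_avg h x <= a /\ prejump_avg h x <= a.
Proof.
move=> uh a0 ha; have [_ h0 _ _] := uh.
have ma : measurable_fun [set: R] (fun _ : R => a) by exact: measurable_cst.
have maU : measurable_fun [set: borel U] (fun _ : borel U => a) by exact: measurable_cst.
have hV x : flow_avg h x <= a.
  rewrite -[leRHS](integral_probability_cst nu); apply: ge0_le_integral => //.
  exact: measurable_flow_test_at.
move=> x; split => //; rewrite -[leRHS](integral_probability_cst mu).
have uV := unit_increasing_flow_avg polish_S Phi_flow nu Phi_mono uh.
have [_ v0 _ _] := uV.
by apply: ge0_le_integral => //; exact: measurable_jump_test_at.
Qed.

Lemma prejump_avg_ge h (a r : \bar R) : ui h -> 0 <= a -> 0 <= r -> (forall x, a <= h x + r) ->
  forall x, a <= flow_avg h x + r /\ a <= prejump_avg h x + r.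
Proof.
move=> uh a0 r0 ha; have [_ h0 _ _] := uh.
have ma : measurable_fun [set: R] (fun _ : R => a) by exact: measurable_cst.
have maU : measurable_fun [set: borel U] (fun _ : borel U => a) by exact: measurable_cst.
have hV x : a <= flow_avg h x + r.
  rewrite -[leLHS](integral_probability_cst nu); apply: ge0_integral_leD => //.
  exact: measurable_flow_test_at.
move=> x; split => //; rewrite -[leLHS](integral_probability_cst mu).
have uV := unit_increasing_flow_avg polish_S Phi_flow nu Phi_mono uh.
have [_ v0 _ _] := uV.
by apply: ge0_integral_leD => //; exact: measurable_jump_test_at.
Qed.

(** The invariant law is that of the backward limit. The limit lies between the
    two backward chains, whose averages of [h] are averages of the [n]-th iterate
    of [h]; so the average of [h] under the law lies in the range of that
    iterate, up to its oscillation. Applied to [k] and to the image of [k], this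
    places both averages within a vanishing distance of each other. *)
Lemma exists_prejump_invariant (p : R) : (0 < p <= 1)%R ->
  p%:E <= (mu \x mu) [set q | ((f2 q.1 : S) <= (f1 q.2 : S))%O] ->
  exists phi : probability (borel S) R,
    forall k, ui k -> \int[phi]_x prejump_avg k x = \int[phi]_x k x.
Proof.
move=> /andP[p0 p1] pM; have [L LE] := back_limit.
have p01 : (0 <= p <= 1)%R by rewrite ltW.
exists (distribution P L) => k uk.
have phiE h : ui h -> \int[distribution P L]_x h x = \int[P]_w h (L w).
  by move=> [mh h0 _ _]; rewrite ge0_integral_pushforward.
pose r n : R := ((1 - p) ^+ n)%R.
have r0 n : 0 <= (r n)%:E by rewrite lee_fin exprn_ge0// subr_ge0.
have bnd n h : ui h -> forall y,
    \int[distribution P L]_x h x <= iter n prejump_avg h y + (r n)%:E /\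
    iter n prejump_avg h y <= \int[distribution P L]_x h x + (r n)%:E.
  move=> uh y; rewrite phiE//; have [mh h0 _ hi] := uh.
  have [ua oa] := iter_prejump_avg_osc n p01 pM uh; have [_ a0 _ _] := ua.
  have uV := unit_increasing_flow_avg polish_S Phi_flow nu Phi_mono ua; have [mv v0 _ _] := uV.
  have mhL : measurable_fun [set: Omega] (fun w => h (L w)).
    by apply: (measurableT_comp mh); exact: (measurable_funPT L).
  have mhb g : measurable_fun [set: borel U] g -> measurable_fun [set: Omega] (fun w => h (back g n 0 w)).
    by move=> mg; apply: (measurableT_comp mh); exact: (info_measurable (@measurable_back g n 0 mg)).
  split.
    apply: (@le_trans _ _ (\int[P]_w h (back f2 n 0 w))).
      apply: ae_ge0_le_integral => //; first exact: mhb.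
      by apply: filterS LE => w h12 _; apply: hi; have [] := h12 n.
    rewrite integral_back// -[leRHS](integral_probability_cst mu).
    apply: ge0_le_integral => //.
    - exact: (measurableT_comp mv mf2).
    - move=> u _; have ar0 : 0 <= iter n prejump_avg h y + (r n)%:E by exact: adde_ge0.
      by have [] := prejump_avg_le ua ar0 (fun x => oa x y) (f2 u).
  apply: (@le_trans _ _ (\int[P]_w h (back f1 n 0 w) + (r n)%:E)); last first.
    apply: leeD2r; apply: ae_ge0_le_integral => //; first exact: mhb.
    by apply: filterS LE => w h12 _; apply: hi; have [] := h12 n.
  rewrite integral_back// -[leLHS](integral_probability_cst mu).
  apply: ge0_integral_leD => //.
  - exact: (measurableT_comp mv mf1).
  - by move=> u; have [] := prejump_avg_ge ua (a0 y) (r0 n) (oa y) (f1 u).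
have urk := unit_increasing_prejump_avg uk.
have close n : \int[distribution P L]_x prejump_avg k x <=
      \int[distribution P L]_x k x + (3 * r n)%:E /\
    \int[distribution P L]_x k x <=
      \int[distribution P L]_x prejump_avg k x + (3 * r n)%:E.
  have [ua oa] := iter_prejump_avg_osc n p01 pM uk; have [_ a0 _ _] := ua.
  have [_ k0 _ _] := uk.
  have phik0 : 0 <= \int[distribution P L]_x k x by exact: integral_ge0.
  have [b1 b2] := bnd n _ urk point; rewrite -iterSr iterS in b1 b2.
  have -> : (3 * r n)%:E = (r n)%:E + (r n)%:E + (r n)%:E.
    by rewrite -!EFinD; congr _%:E; rewrite -/(r n); lra.
  split.
    apply: (le_trans b1); rewrite !addeA; apply: leeD2r.
    have [//|_ +] := prejump_avg_le ua _ (fun x => oa x point) point.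
      exact: adde_ge0.
    move/le_trans; apply; apply: leeD2r.
    by have [] := bnd n _ uk point.
  have [_ b3] := prejump_avg_ge ua phik0 (r0 n) (fun y => (bnd n _ uk y).1) point.
  apply: (le_trans b3); rewrite addeA; apply: leeD2r.
  apply: (le_trans b2); rewrite addeA; exact: leeDl.
have small (e : R) : (0 < e)%R -> exists n, (3 * r n <= e)%R.
  move=> e0; have [||n ne] := @exists_expr_le R (1 - p)%R (e / 3)%R.
  - by rewrite subr_ge0 p1 ltrBlDr ltrDl.
  - by rewrite divr_gt0.
  - by exists n; rewrite mulrC -ler_pdivlMr.
apply/le_anti/andP; split; apply/lee_addgt0Pr => e /small[n ne];
  have [c1 c2] := close n.
- by apply: (le_trans c1); apply: leeD2l; rewrite lee_fin.
- by apply: (le_trans c2); apply: leeD2l; rewrite lee_fin.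
Qed.

End Backward.

(** * The process path by path: decomposition by number of jumps *)

Section Forward.
Context (R : realType) (disp : Order.disp_t) (S : POrderedPointedTopological.type disp).
Context (polish_S : polish R S).
Context (U : ptopologicalType).
Context (Phi : S -> R -> S) (Phi_flow : continuous_semiflow Phi).
Context (lambda : R) (lambda_gt0 : 0 < lambda) (mu : probability (borel U) R).
Context (F : S -> U -> S)
  (mF : measurable_fun [set: borel S * borel U]
          ((fun z => F z.1 z.2) : borel S * borel U -> borel S)).
Context d (Omega : measurableType d) (P : probability Omega R).
Context (E : nat -> {RV P >-> R}) (xi : nat -> {RV P >-> borel U}).
Context (noise : pdmp_noise E xi lambda mu).
Context (Phi_mono : forall t, 0 <= t -> order_preserving (Phi ^~ t))
  (F_mono : forall u, order_preserving (F ^~ u)).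

Local Notation G := (noise_sigma_algebra E xi).
Notation info D := (g_sigma_algebraType (cylinders G D)).
Local Notation flow := (flow Phi).
Local Notation nu := (distribution P (E 0%N)).
Local Notation shock_avg := (shock_avg mu F).
Local Notation ui := (@unit_increasing R disp S).

Definition state (x : S) (n : nat) (w : Omega) : S :=
  embedded_chain Phi F x (E ^~ w) (xi ^~ w) n.
Definition clock (n : nat) (w : Omega) : R := jump_time (E ^~ w) n.

Let E_ge0 n w : 0 <= E n w. Proof. by have [h _ _ _] := noise. Qed.

Lemma stateS x n w : state x n.+1 w = F (flow (state x n w) (E n w)) (xi n w).
Proof. by rewrite /= flowE. Qed.

Lemma clockS n w : clock n.+1 w = clock n w + E n w.
Proof. by rewrite /clock /jump_time big_ord_recr. Qed.

Lemma clock0 w : clock 0 w = 0.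
Proof. by rewrite /clock /jump_time big_ord0. Qed.

Lemma clock_le m n w : (m <= n)%N -> clock m w <= clock n w.
Proof.
move=> /subnK <-; elim: (n - m)%N => // k IH.
by rewrite addSn clockS (le_trans IH)// lerDl.
Qed.

Lemma clock_ge0 n w : 0 <= clock n w.
Proof. by rewrite -(clock0 w) clock_le. Qed.

Definition past (n : nat) : set (nat + nat) :=
  [set i | match i with inl k | inr k => (k < n)%N end].

Lemma measurable_clock n : measurable_fun [set: info (past n)] (clock n : info (past n) -> R).
Proof.
apply: measurable_sum => i; apply: info_wait; rewrite /past /=; exact: ltn_ord.
Qed.

Lemma measurable_state n (D : set (nat + nat)) : past n `<=` D ->
  measurable_fun [set: borel S * info D]
    (fun z : borel S * info D => state z.1 n z.2 : borel S).
Proof.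
elim: n => [|n IH] nD; first exact: measurable_fst.
have mE : measurable_fun [set: borel S * info D] (fun z : borel S * info D => E n z.2).
  apply: (measurableT_comp _ measurable_snd).
  by apply: info_wait; apply: nD; rewrite /past /=.
have mx : measurable_fun [set: borel S * info D] (fun z : borel S * info D => xi n z.2).
  apply: (measurableT_comp _ measurable_snd).
  by apply: info_shock; apply: nD; rewrite /past /=.
have mZ : measurable_fun [set: borel S * info D]
    (fun z : borel S * info D => state z.1 n z.2 : borel S).
  by apply: IH => -[] k /= kn; apply: nD; rewrite /past /= ltnW.
have mf := measurableT_comp (measurable_flow Phi_flow polish_S) (measurable_fun_pair mZ mE).
have := measurableT_comp mF (measurable_fun_pair mf mx).
by apply: eq_measurable_fun => z _; rewrite stateS.
Qed.

Lemma measurable_state_at x n : measurable_fun [set: info (past n)]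
  (state x n : info (past n) -> borel S).
Proof.
have m : measurable_fun [set: info (past n)] (fun w : info (past n) => (x : borel S, w)).
  exact: measurable_fun_pair.
exact: (measurableT_comp (measurable_state (D := past n) (fun=> id)) m).
Qed.

Let mid D : measurable_fun [set: Omega] (id : Omega -> info D).
Proof. by apply: info_measurable; exact: measurable_id. Qed.

Lemma measurable_state_joint n : measurable_fun [set: borel S * Omega]
  (fun z : borel S * Omega => state z.1 n z.2 : borel S).
Proof.
have m2 : measurable_fun [set: borel S * Omega] (snd : borel S * Omega -> Omega).
  exact: measurable_snd.
have m1 : measurable_fun [set: borel S * Omega] (fst : borel S * Omega -> borel S).
  exact: measurable_fst.
have m3 := measurable_fun_pair m1 (measurableT_comp (@mid (past n)) m2).
exact: (measurableT_comp (measurable_state (D := past n) (fun=> id)) m3).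
Qed.

Lemma measurable_clock_joint n : measurable_fun [set: Omega] (clock n).
Proof. by apply: measurable_sum => i; exact: (measurable_funPT (E i)). Qed.

Local Open Scope ereal_scope.
Local Notation surv := (survival lambda).

(** The contribution to the average of [h] at time [t] of the paths with exactly
    [n] jumps, the waiting time in progress being averaged out. *)
Definition piece (x : S) (n : nat) (t : R) (h : S -> \bar R) : \bar R :=
  \int[P]_w ((surv (t - clock n w))%:E * h (flow (state x n w) (t - clock n w))).

Lemma measurable_surv_time n : measurable_fun [set: (borel S * R) * Omega]
  (fun z => (z.1.2 - clock n z.2)%R).
Proof.
apply: measurable_funB.
  exact: (measurableT_comp measurable_snd measurable_fst).
exact: (measurableT_comp (measurable_clock_joint n) measurable_snd).
Qed.

Lemma measurable_piece_integrand n (k : R * borel S -> \bar R) :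
  measurable_fun [set: R * borel S] k ->
  measurable_fun [set: (borel S * R) * Omega]
    (fun z => (surv (z.1.2 - clock n z.2))%:E *
      k (z.1.2, flow (state z.1.1 n z.2) (z.1.2 - clock n z.2))).
Proof.
move=> mk; have mt := measurable_surv_time n.
have ms : measurable_fun [set: R] (fun r => (surv r)%:E : \bar R).
  by apply/measurable_EFinP; exact: measurable_surv.
apply: emeasurable_funM; first exact: (measurableT_comp ms mt).
have m1 : measurable_fun [set: (borel S * R) * Omega] (fun z => z.1.1).
  exact: (measurableT_comp measurable_fst measurable_fst).
have m2 : measurable_fun [set: (borel S * R) * Omega] (fun z => z.1.2).
  exact: (measurableT_comp measurable_snd measurable_fst).
have m3 : measurable_fun [set: (borel S * R) * Omega] (fun z => z.2).
  exact: measurable_snd.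
have mZ := measurableT_comp (measurable_state_joint n) (measurable_fun_pair m1 m3).
have mf := measurableT_comp (measurable_flow Phi_flow polish_S) (measurable_fun_pair mZ mt).
exact: (measurableT_comp mk (measurable_fun_pair m2 mf)).
Qed.

Let surv0 r : 0 <= (surv r)%:E. Proof. by rewrite lee_fin surv_ge0. Qed.

Lemma piece_ge0 x n t h : ui h -> 0 <= piece x n t h.
Proof. by move=> [_ h0 _ _]; apply: integral_ge0 => w _; exact: mule_ge0. Qed.

Lemma piece_lt0 x n t h : (t < 0)%R -> piece x n t h = 0.
Proof.
move=> t0; apply: integral0_eq => w _; rewrite surv_lt0 ?mul0e//.
by rewrite subr_lt0 (lt_le_trans t0)// clock_ge0.
Qed.

Lemma piece0 x t h : piece x 0 t h = (surv t)%:E * h (flow x t).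
Proof.
rewrite -[RHS](integral_probability_cst P); apply: eq_integral => w _.
by rewrite clock0 subr0.
Qed.

(** Splitting off the last jump before [t]. Given the first [n] waiting times,
    the last one and the age [r] of the last jump add up to a constant, and
    [exponential_reflection] exchanges them. *)
Lemma piece_last_jump x n t h : ui h ->
  piece x n.+1 t h = \int[nu]_r piece x n (t - r) (shock_avg (h \o flow ^~ r)).
Proof.
move=> uh; have [mh h0 h1 hi] := uh.
have ms : measurable_fun [set: R] (fun r => (surv r)%:E : \bar R).
  by apply/measurable_EFinP; exact: measurable_surv.
have mflow := measurable_flow Phi_flow polish_S.
pose D' : set (nat + nat) := [set i | past n i \/ i = inl n].
have mZ := @measurable_state_at x n; have mT := @measurable_clock n.
have mZ' : measurable_fun [set: info D'] (state x n : info D' -> borel S).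
  by apply: info_weaken mZ => i; left.
have mT' : measurable_fun [set: info D'] (clock n : info D' -> R).
  by apply: info_weaken mT => i; left.
have mE' : measurable_fun [set: info D'] (E n : info D' -> R).
  by apply: info_wait; right.
pose T3 := ((borel S * R) * R)%type.
pose f (z : T3 * borel U) : \bar R := (surv (t - (z.1.1.2 + z.1.2)))%:E *
  h (flow (F (flow z.1.1.1 z.1.2) z.2) (t - (z.1.1.2 + z.1.2))).
have m111 : measurable_fun [set: T3] (fun z : T3 => z.1.1).
  exact: (measurableT_comp measurable_fst measurable_fst).
have m112 : measurable_fun [set: T3] (fun z : T3 => z.1.2).
  exact: (measurableT_comp measurable_snd measurable_fst).
have m12 : measurable_fun [set: T3] (fun z : T3 => z.2).
  exact: measurable_snd.
have mtau : measurable_fun [set: T3] (fun z : T3 => t - (z.1.2 + z.2))%R.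
  by apply: measurable_funB => //; exact: measurable_funD.
have mfl : measurable_fun [set: T3] (fun z : T3 => flow z.1.1 z.2 : borel S).
  exact: (measurableT_comp mflow (measurable_fun_pair m111 m12)).
have mf1 : measurable_fun [set: T3 * borel U] (fun z : T3 * borel U => z.1).
  exact: measurable_fst.
have mf2 : measurable_fun [set: T3 * borel U] (fun z : T3 * borel U => z.2).
  exact: measurable_snd.
have mf : measurable_fun [set: T3 * borel U] f.
  apply: emeasurable_funM.
    exact: (measurableT_comp ms (measurableT_comp mtau mf1)).
  have a1 := measurableT_comp mF (measurable_fun_pair (measurableT_comp mfl mf1) mf2).
  have a2 := measurable_fun_pair a1 (measurableT_comp mtau mf1).
  exact: (measurableT_comp mh (measurableT_comp mflow a2)).
have f0 z : 0 <= f z by apply: mule_ge0.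
pose g (z : T3) : \bar R := (surv (t - (z.1.2 + z.2)))%:E *
  shock_avg (h \o flow ^~ (t - (z.1.2 + z.2))%R) (flow z.1.1 z.2).
have msh := measurable_shock_avg_flow polish_S Phi_flow mu mF uh.
have mg : measurable_fun [set: T3] g.
  apply: emeasurable_funM; first exact: (measurableT_comp ms mtau).
  exact: (measurableT_comp msh (measurable_fun_pair mtau mfl)).
have g0 z : 0 <= g z.
  by apply: mule_ge0 => //; apply: integral_ge0 => u _; exact: h0.
transitivity (\int[P]_w f (((state x n w : borel S, clock n w), E n w), xi n w)).
  by apply: eq_integral => w _; rewrite /f clockS stateS.
rewrite (integral_next_shock noise (T1 := T3) (D := D') (n := n)
  (Y := fun w => ((state x n w : borel S, clock n w), E n w)) (f := f))//; last 2 first.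
- by case=> [|//]; rewrite /past /= ltnn.
- exact: (measurable_fun_pair (measurable_fun_pair mZ' mT') mE').
transitivity (\int[P]_w g ((state x n w : borel S, clock n w), E n w)).
  apply: eq_integral => w _; rewrite /f /g /= ge0_integralZl//.
  have uht := unit_increasing_flow polish_S Phi_flow Phi_mono (t - (clock n w + E n w))%R uh.
  exact: (measurable_jump_test_at mF (flow (state x n w) (E n w)) uht).
rewrite (integral_next_wait noise (T1 := (borel S * R)%type) (D := past n) (n := n)
  (Y := fun w => (state x n w : borel S, clock n w)) (f := g))//; last 2 first.
- by rewrite /past /= ltnn.
- exact: measurable_fun_pair.
have mtr : measurable_fun [set: R] (fun r : R => t - r)%R by exact: measurable_funB.
pose k (z : R * borel S) := shock_avg (h \o flow ^~ (t - z.1)%R) z.2.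
have mk : measurable_fun [set: R * borel S] k.
  exact: (measurableT_comp msh (measurable_fun_pair
    (measurableT_comp mtr measurable_fst) measurable_snd)).
have k0 z : 0 <= k z by apply: integral_ge0 => u _; exact: h0.
pose K (z : Omega * R) := (surv (t - z.2 - clock n z.1))%:E *
  shock_avg (h \o flow ^~ z.2) (flow (state x n z.1) (t - z.2 - clock n z.1)).
have mK : measurable_fun [set: Omega * R] K.
  have m1 : measurable_fun [set: Omega * R] (fun z : Omega * R => ((x : borel S, t - z.2)%R, z.1)).
    apply: measurable_fun_pair => //; apply: measurable_fun_pair => //.
    exact: (measurableT_comp mtr measurable_snd).
  have := measurableT_comp (measurable_piece_integrand n mk) m1.
  by apply: eq_measurable_fun => z _; rewrite /K /k /= subKr.
have K0 z : 0 <= K z.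
  by apply: mule_ge0 => //; apply: integral_ge0 => u _; exact: h0.
transitivity (\int[P]_w \int[nu]_r K (w, r)); last first.
  by rewrite (fubini_tonelli (m1 := P) (m2 := nu)).
apply: eq_integral => w _; set s := clock n w; set z := state x n w.
pose q (e : R) := shock_avg (h \o flow ^~ (t - s - e)%R) (flow z e).
have mq : measurable_fun [set: R] q.
  have m1 : measurable_fun [set: R] (fun e : R => t - s - e)%R by exact: measurable_funB.
  have m2 : measurable_fun [set: R] (fun e : R => flow z e : borel S).
    have m3 : measurable_fun [set: R] (fun e : R => (z : borel S, e)).
      exact: measurable_fun_pair.
    exact: (measurableT_comp mflow m3).
  exact: (measurableT_comp msh (measurable_fun_pair m1 m2)).
have q0 e : 0 <= q e by apply: integral_ge0 => u _; exact: h0.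
have := exponential_reflection lambda_gt0 (wait_lawE noise) (t - s)%R mq q0.
rewrite (_ : \int[nu]_e (_ * q e) = \int[nu]_e g ((z : borel S, s), e)); last first.
  by apply: eq_integral => e _; rewrite /g /q /= opprD addrA.
move=> ->; apply: eq_integral => r _.
rewrite /K /q /= subKr -/s -/z; congr ((surv _)%:E * shock_avg _ (flow _ _)); lra.
Qed.

End Forward.

(** * The renewal equation, merging and invariance *)

Section Renewal.
Context (R : realType) (disp : Order.disp_t) (S : POrderedPointedTopological.type disp).
Context (polish_S : polish R S).
Context (U : ptopologicalType).
Context (Phi : S -> R -> S) (Phi_flow : continuous_semiflow Phi).
Context (lambda : R) (lambda_gt0 : 0 < lambda) (mu : probability (borel U) R).
Context (F : S -> U -> S)
  (mF : measurable_fun [set: borel S * borel U]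
          ((fun z => F z.1 z.2) : borel S * borel U -> borel S)).
Context d (Omega : measurableType d) (P : probability Omega R).
Context (E : nat -> {RV P >-> R}) (xi : nat -> {RV P >-> borel U}).
Context (noise : pdmp_noise E xi lambda mu).
Context (Phi_mono : forall t, 0 <= t -> order_preserving (Phi ^~ t))
  (F_mono : forall u, order_preserving (F ^~ u)).

Local Notation G := (noise_sigma_algebra E xi).
Notation info D := (g_sigma_algebraType (cylinders G D)).
Local Notation flow := (flow Phi).
Local Notation nu := (distribution P (E 0%N)).
Local Notation shock_avg := (shock_avg mu F).
Local Notation ui := (@unit_increasing R disp S).


Local Notation clock := (clock E).
Local Notation state := (state Phi F E xi).
Local Notation surv := (survival lambda).
Local Notation piece := (piece Phi lambda F E xi).
Local Open Scope ereal_scope.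

Let surv0 r : 0 <= (surv r)%:E. Proof. by rewrite lee_fin surv_ge0. Qed.

Lemma unit_increasing_aged h r : ui h -> ui (shock_avg (h \o flow ^~ r)).
Proof.
by move=> uh; apply: unit_increasing_shock_avg => //; exact: (unit_increasing_flow polish_S).
Qed.

Lemma measurable_piece n t h : ui h ->
  measurable_fun [set: borel S] (fun x : borel S => piece x n t h).
Proof.
move=> [mh h0 _ _].
have mk : measurable_fun [set: R * borel S] (fun z : R * borel S => h z.2).
  exact: (measurableT_comp mh measurable_snd).
have m1 : measurable_fun [set: borel S * Omega] (fun z : borel S * Omega => ((z.1, t), z.2)).
  by apply: measurable_fun_pair => //; exact: measurable_fun_pair.
apply: (measurable_fun_fubini_tonelli_F (m2 := P) (fun z : borel S * Omega =>
  (surv (t - clock n z.2))%:E * h (flow (state z.1 n z.2) (t - clock n z.2)))).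
  exact: (measurableT_comp (measurable_piece_integrand polish_S Phi_flow mF noise n mk) m1).
by move=> z; exact: mule_ge0.
Qed.

Lemma measurable_aged_piece n t h : ui h ->
  measurable_fun [set: R * borel S]
    (fun z : R * borel S => piece z.2 n (t - z.1)%R (shock_avg (h \o flow ^~ z.1))).
Proof.
move=> uh; have [mh h0 _ _] := uh.
have msh := measurable_shock_avg_flow polish_S Phi_flow mu mF uh.
have mtr : measurable_fun [set: R] (fun r : R => t - r)%R by exact: measurable_funB.
pose k (z : R * borel S) := shock_avg (h \o flow ^~ (t - z.1)%R) z.2.
have mk : measurable_fun [set: R * borel S] k.
  exact: (measurableT_comp msh (measurable_fun_pair
    (measurableT_comp mtr measurable_fst) measurable_snd)).
apply: (measurable_fun_fubini_tonelli_F (m2 := P) (fun z : (R * borel S) * Omega =>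
  (surv (t - z.1.1 - clock n z.2))%:E *
    shock_avg (h \o flow ^~ z.1.1) (flow (state z.1.2 n z.2) (t - z.1.1 - clock n z.2)))).
  have m1 : measurable_fun [set: (R * borel S) * Omega]
      (fun z : (R * borel S) * Omega => ((z.1.2, t - z.1.1)%R, z.2)).
    apply: measurable_fun_pair => //; apply: measurable_fun_pair.
      exact: (measurableT_comp measurable_snd measurable_fst).
    exact: (measurableT_comp mtr (measurableT_comp measurable_fst measurable_fst)).
  have := measurableT_comp (measurable_piece_integrand polish_S Phi_flow mF noise n mk) m1.
  by apply: eq_measurable_fun => z _; rewrite /k /= subKr.
by move=> z; apply: mule_ge0 => //; apply: integral_ge0 => u _; exact: h0.
Qed.

(** The part of the average of [h] at time [t], for the initial law [phi], that
    comes from paths with fewer than [n] jumps. *)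
Definition total (phi : probability (borel S) R) (n : nat) (t : R) (h : S -> \bar R) : \bar R :=
  \sum_(k < n) \int[phi]_x piece x k t h.

Lemma piece_avg_ge0 (phi : probability (borel S) R) k t h : ui h ->
  0 <= \int[phi]_x piece x k t h.
Proof. by move=> uh; apply: integral_ge0 => x _; exact: piece_ge0. Qed.

Lemma total_ge0 phi n t h : ui h -> 0 <= total phi n t h.
Proof. by move=> uh; apply: sume_ge0 => k _; exact: piece_avg_ge0. Qed.

Lemma total_lt0 phi n t h : (t < 0)%R -> total phi n t h = 0.
Proof.
move=> t0; apply: big1 => k _; apply: integral0_eq => x _.
exact: (piece_lt0 Phi F noise).
Qed.

Lemma measurable_aged_piece_avg (phi : probability (borel S) R) n t h : ui h ->
  measurable_fun [set: R]
    (fun r => \int[phi]_x piece x n (t - r)%R (shock_avg (h \o flow ^~ r))).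
Proof.
move=> uh; apply: (measurable_fun_fubini_tonelli_F (m2 := phi) _ (measurable_aged_piece n t uh)).
by move=> z; apply: piece_ge0; exact: unit_increasing_aged.
Qed.

Lemma measurable_aged_total phi n t h : ui h ->
  measurable_fun [set: R] (fun r => total phi n (t - r)%R (shock_avg (h \o flow ^~ r))).
Proof.
by move=> uh; apply: emeasurable_sum => k; exact: measurable_aged_piece_avg.
Qed.

Lemma measurable_aged_invariant (phi : probability (borel S) R) t h : ui h ->
  measurable_fun [set: R]
    (fun r => ((0 <= t - r)%R%:R : R)%:E * \int[phi]_x shock_avg (h \o flow ^~ r) x).
Proof.
move=> uh; have [_ h0 _ _] := uh; apply: emeasurable_funM.
  apply/measurable_EFinP.
  have mB : measurable_fun [set: R] (fun r : R => t - r)%R by exact: measurable_funB.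
  exact: (measurableT_comp (@measurable_ge0 R) mB).
apply: (measurable_fun_fubini_tonelli_F (m2 := phi) _
  (measurable_shock_avg_flow polish_S Phi_flow mu mF uh)).
by move=> z; apply: integral_ge0 => u _; exact: h0.
Qed.

(** The paths without jump give the first term, and [piece_last_jump] the
    second. *)
Lemma total_renewal phi n t h : ui h ->
  total phi n.+1 t h = (surv t)%:E * \int[phi]_x h (flow x t) +
    \int[nu]_r total phi n (t - r)%R (shock_avg (h \o flow ^~ r)).
Proof.
move=> uh; have [mh h0 _ _] := uh; rewrite /total big_ord_recl; congr (_ + _).
  under eq_integral do rewrite piece0//.
  rewrite ge0_integralZl//.
  exact: (measurableT_comp mh (measurable_flow_at polish_S Phi_flow t)).
rewrite ge0_integral_sum//; last 2 first.
- by move=> k; exact: measurable_aged_piece_avg.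
- by move=> k r _; apply: piece_avg_ge0; exact: unit_increasing_aged.
apply: eq_bigr => k _.
transitivity (\int[phi]_x \int[nu]_r piece x k (t - r)%R (shock_avg (h \o flow ^~ r))).
  apply: eq_integral => x _; have -> : (lift ord0 k : nat) = k.+1 by [].
  exact: (piece_last_jump polish_S Phi_flow lambda_gt0 mF noise Phi_mono).
rewrite -(fubini_tonelli (m1 := nu) (m2 := phi)
  (fun z : R * borel S => piece z.2 k (t - z.1)%R (shock_avg (h \o flow ^~ z.1))))//.
- exact: measurable_aged_piece.
- by move=> z; apply: piece_ge0; exact: unit_increasing_aged.
Qed.

Let measurable_ui h : ui h -> measurable_fun [set: borel S] (h : borel S -> \bar R).
Proof. by case. Qed.

(** Jumps act like a merging of the two initial laws that happens with
    probability [p] at each jump, hence at rate [lambda * p]: inserted into the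
    renewal equation, the bound reproduces itself by [exponential_thinning]. *)
Lemma total_contraction (p : R) (phi psi : probability (borel S) R) : (0 < p < 1)%R ->
  (forall (dl : R) h, (0 <= dl)%R -> ui h -> (forall x y, h x <= h y + dl%:E) ->
    forall x y, shock_avg h x <= shock_avg h y + ((1 - p) * dl)%:E) ->
  forall n (dl t : R) h, (0 <= dl)%R -> ui h -> (forall x y, h x <= h y + dl%:E) ->
  total phi n t h <= total psi n t h + (dl * survival (lambda * p) t)%:E.
Proof.
move=> p01 contr; elim=> [|n IH] dl t h dl0 uh oh.
  by rewrite {1}/total big_ord0 adde_ge0 ?total_ge0// lee_fin mulr_ge0 ?surv_ge0.
have [t0|t0] := ltP t 0%R.
  by rewrite !total_lt0// add0e lee_fin mulr_ge0 ?surv_ge0.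
have [mh h0 h1 hi] := uh; have /andP[p0 p1] := p01.
have q0 : (0 <= (1 - p) * dl)%R by rewrite mulr_ge0// subr_ge0 ltW.
have mS : measurable_fun [set: R] (fun r : R => (survival (lambda * p) (t - r))%:E).
  apply/measurable_EFinP; apply: (measurableT_comp (measurable_surv _)).
  exact: measurable_funB.
have uht := unit_increasing_flow polish_S Phi_flow Phi_mono t uh.
have mht := measurable_ui uht.
rewrite !total_renewal// [(dl * _)%:E]EFinM -(exponential_thinning lambda_gt0 (wait_lawE noise) p01 t0).
(* Without jump the initial laws are compared through the oscillation of [h]
   alone; a last jump has already multiplied it by [1 - p]. *)
have c1 : \int[phi]_x h (flow x t) <= \int[psi]_x h (flow x t) + dl%:E.
  have a y : \int[phi]_x h (flow x t) <= h (flow y t) + dl%:E.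
    rewrite -[leRHS](integral_probability_cst phi); exact: ge0_le_integral.
  rewrite -[leLHS](integral_probability_cst psi).
  by apply: ge0_integral_leD => // _; exact: integral_ge0.
have c2 : \int[nu]_r total phi n (t - r)%R (shock_avg (h \o flow ^~ r)) <=
    \int[nu]_r total psi n (t - r)%R (shock_avg (h \o flow ^~ r)) +
    ((1 - p) * dl)%:E * \int[nu]_r (survival (lambda * p) (t - r))%:E.
  rewrite -ge0_integralZl//; last by move=> r _; rewrite lee_fin surv_ge0.
  rewrite -ge0_integralD//; last 4 first.
  - by move=> r _; apply: total_ge0; exact: unit_increasing_aged.
  - exact: measurable_aged_total.
  - by move=> r _; rewrite mule_ge0// lee_fin surv_ge0.
  - exact: measurable_funeM.
  apply: ge0_le_integral => //.
  - by move=> r _; apply: total_ge0; exact: unit_increasing_aged.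
  - exact: measurable_aged_total.
  - by apply: emeasurable_funD; [exact: measurable_aged_total|exact: measurable_funeM].
  - move=> r _; rewrite -EFinM; apply: IH => //; first exact: unit_increasing_aged.
    apply: contr => // [|x y]; last exact: oh.
    exact: (unit_increasing_flow polish_S Phi_flow Phi_mono).
apply: (le_trans (leeD (lee_wpmul2l (surv0 t) c1) c2)).
set A := (\int[psi]_x h (flow x t))%E.
have A0 : 0 <= A by exact: integral_ge0.
move: A0; move: A => A A0.
have : 0 <= \int[nu]_r (survival (lambda * p) (t - r))%:E.
  by apply: integral_ge0 => r _; rewrite lee_fin surv_ge0.
move: (\int[nu]_r (survival (lambda * p) (t - r))%:E) => I I0.
move: (\int[nu]_r total psi n (t - r)%R (shock_avg (h \o flow ^~ r))) => B.
have I10 : 0 <= (1 - p)%:E * I by rewrite mule_ge0// lee_fin subr_ge0 ltW.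
rewrite !ge0_muleDr//.
by rewrite addeACA [dl%:E * (surv t)%:E]muleC (muleA dl%:E) -(EFinM dl) (mulrC dl).
Qed.

(** Both bounds come from comparing the renewal equation of [total] with the
    renewal identity of an invariant law, term by term. *)
Lemma total_le_invariant (phi : probability (borel S) R) :
  (forall k, ui k -> \int[phi]_x shock_avg (flow_avg Phi nu k) x = \int[phi]_x k x) ->
  forall n t h, ui h -> total phi n t h <= \int[phi]_x h x.
Proof.
move=> inv; elim=> [|n IH] t h uh; have [mh h0 h1 hi] := uh.
  by rewrite /total big_ord0; exact: integral_ge0.
have [t0|t0] := ltP t 0%R; first by rewrite total_lt0//; exact: integral_ge0.
rewrite total_renewal// (prejump_invariant_renewal polish_S Phi_flow mF Phi_mono
  lambda_gt0 (wait_lawE noise) t0 inv uh).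
apply: leeD2l; apply: ge0_le_integral => //.
- by move=> r _; apply: total_ge0; exact: unit_increasing_aged.
- exact: measurable_aged_total.
- exact: measurable_aged_invariant.
- move=> r _; have [r0|r0] := ltP (t - r)%R 0%R.
    by rewrite total_lt0// mul0e.
  by rewrite mul1e; apply: IH; exact: unit_increasing_aged.
Qed.

(** Paths with [n] jumps or more are missing from [total], which costs at most
    the probability that [n] ages in a row stay below [T]. The bound is uniform
    in [t <= T] because the induction shortens [t]. *)
Lemma invariant_le_total (phi : probability (borel S) R) (T : R) : (0 <= T)%R ->
  (forall k, ui k -> \int[phi]_x shock_avg (flow_avg Phi nu k) x = \int[phi]_x k x) ->
  forall n t h, (0 <= t <= T)%R -> ui h ->
  \int[phi]_x h x <= total phi n t h + ((1 - surv T) ^+ n)%:E.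
Proof.
move=> T0 inv; elim=> [|n IH] t h /andP[t0 tT] uh; have [mh h0 h1 hi] := uh.
  by rewrite /total big_ord0 add0e expr0; exact: integral_le1.
have c0 : (0 <= 1 - surv T)%R by rewrite subr_ge0 surv_le1// ltW.
have cn0 : (0 <= (1 - surv T) ^+ n)%R by rewrite exprn_ge0.
rewrite total_renewal// (prejump_invariant_renewal polish_S Phi_flow mF Phi_mono
  lambda_gt0 (wait_lawE noise) t0 inv uh) -addeA; apply: leeD2l.
have mH : measurable_fun [set: R] (fun r : R => (((0 <= t - r)%R%:R : R) * (1 - surv T) ^+ n)%:E).
  apply/measurable_EFinP; apply: measurable_funM => //.
  have mB : measurable_fun [set: R] (fun r : R => t - r)%R by exact: measurable_funB.
  exact: (measurableT_comp (@measurable_ge0 R) mB).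
apply: (@le_trans _ _ (\int[nu]_r (total phi n (t - r)%R (shock_avg (h \o flow ^~ r)) +
    (((0 <= t - r)%R%:R : R) * (1 - surv T) ^+ n)%:E))).
  apply: ae_ge0_le_integral => //.
  - by move=> r _; rewrite mule_ge0// ?lee_fin//; apply: integral_ge0 => x _; apply: integral_ge0 => u _; exact: h0.
  - exact: measurable_aged_invariant.
  - by move=> r _; rewrite adde_ge0 ?lee_fin ?mulr_ge0//; apply: total_ge0; exact: unit_increasing_aged.
  - by apply: emeasurable_funD => //; exact: measurable_aged_total.
  exists [set r | r < 0]%R; split.
  - by rewrite -[X in measurable X]set_itvNyo; exact: measurable_itv.
  - exact: (exponential_lt0 (wait_lawE noise)).
  move=> r /= hr; rewrite ltNge; apply/negP => r0; apply: hr => _.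
  have [tr|tr] := ltP (t - r)%R 0%R; first by rewrite mul0e mul0r adde0 total_lt0.
  rewrite mul1e mul1r; apply: IH; last exact: unit_increasing_aged.
  by rewrite tr /= (le_trans _ tT)// lerBlDr lerDl.
rewrite ge0_integralD//; last 3 first.
- by move=> r _; apply: total_ge0; exact: unit_increasing_aged.
- exact: measurable_aged_total.
- by move=> r _; rewrite lee_fin mulr_ge0.
apply: leeD2l; rewrite exprSr.
under eq_integral do rewrite mulrC EFinM.
rewrite ge0_integralZl//; last first.
  apply/measurable_EFinP.
  have mB : measurable_fun [set: R] (fun r : R => t - r)%R by exact: measurable_funB.
  exact: (measurableT_comp (@measurable_ge0 R) mB).
rewrite EFinM; apply: lee_wpmul2l => //.
(* An exponential age is at most [t] with probability [1 - surv t], and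
   [t <= T]. *)
have := memoryless lambda_gt0 (wait_lawE noise) t0 (measurable_cst (1 : \bar R)) (fun=> lee01).
rewrite !integral_probability_cst mule1 => h1'.
have {}h1' : 1 = \int[nu]_r ((0 <= t - r)%R%:R : R)%:E + (surv t)%:E.
  by rewrite {1}h1'; congr (_ + _); apply: eq_integral => r _; rewrite /= mule1.
rewrite EFinB leeBrDr// [leRHS]h1'; apply: leeD2l.
rewrite lee_fin !surv_pos// ler_expR lerN2; apply: ler_wpM2l => //; exact: ltW.
Qed.

End Renewal.

(** * From the renewal equation to the paths *)

Section Process.
Context (R : realType) (disp : Order.disp_t) (S : POrderedPointedTopological.type disp).
Context (polish_S : polish R S).
Context (U : ptopologicalType).
Context (Phi : S -> R -> S) (Phi_flow : continuous_semiflow Phi).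
Context (lambda : R) (lambda_gt0 : 0 < lambda) (mu : probability (borel U) R).
Context (F : S -> U -> S)
  (mF : measurable_fun [set: borel S * borel U]
          ((fun z => F z.1 z.2) : borel S * borel U -> borel S)).
Context d (Omega : measurableType d) (P : probability Omega R).
Context (E : nat -> {RV P >-> R}) (xi : nat -> {RV P >-> borel U}).
Context (noise : pdmp_noise E xi lambda mu).
Context (Phi_mono : forall t, 0 <= t -> order_preserving (Phi ^~ t))
  (F_mono : forall u, order_preserving (F ^~ u)).

Local Notation G := (noise_sigma_algebra E xi).
Notation info D := (g_sigma_algebraType (cylinders G D)).
Local Notation flow := (flow Phi).
Local Notation nu := (distribution P (E 0%N)).
Local Notation shock_avg := (shock_avg mu F).
Local Notation ui := (@unit_increasing R disp S).


Local Notation clock := (clock E).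
Local Notation state := (state Phi F E xi).
Local Notation surv := (survival lambda).
Local Notation piece := (piece Phi lambda F E xi).
Local Notation total := (total Phi lambda F E xi).
Local Notation path_at t x w := (pdmp Phi F x (E ^~ w) (xi ^~ w) t).

Lemma clock_lt_inj k m t w : clock k w <= t < clock k.+1 w ->
  clock m w <= t < clock m.+1 w -> k = m.
Proof.
have h k' m' : clock k' w <= t < clock k'.+1 w ->
    clock m' w <= t < clock m'.+1 w -> (k' <= m')%N.
  move=> /andP[k1 k2] /andP[m1 m2]; rewrite leqNgt; apply/negP => mk.
  by have := le_lt_trans (le_trans (clock_le noise w mk) k1) m2; rewrite ltxx.
by move=> hk hm; apply/eqP; rewrite eqn_leq !h.
Qed.

Lemma jump_countE k t w : clock k w <= t < clock k.+1 w -> jump_count (E ^~ w) t = k.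
Proof.
move=> hk; have /andP[k1 k2] := hk.
have kP : [set n | jump_time (E ^~ w) n <= t /\
    forall m, jump_time (E ^~ w) m <= t -> (m <= n)%N] k.
  split=> // m mt; rewrite leqNgt; apply/negP => km.
  by have := lt_le_trans k2 (le_trans (clock_le noise w km) mt); rewrite ltxx.
rewrite /jump_count; case: xgetP => [n _ [nt hn]|/(_ k)//].
by apply/eqP; rewrite eqn_leq hn// andbT; case: kP => _; apply.
Qed.

Lemma jump_count_explosion t w : (forall k, clock k w <= t) -> jump_count (E ^~ w) t = 0%N.
Proof.
move=> h; rewrite /jump_count; case: xgetP => // n _ [_ /(_ n.+1 (h n.+1))].
by rewrite ltnn.
Qed.

(** Infinitely many jumps before [t] form a null event, but the paths of that
    event have a value too, and measurability of the path map needs it. *)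
Lemma jump_cases t w : 0 <= t ->
  (exists k, clock k w <= t < clock k.+1 w) \/ forall k, clock k w <= t.
Proof.
move=> t0; have [h|/existsNP[n nt]] := pselect (forall k, clock k w <= t); first by right.
left; elim: n nt => [|n IH] nt; first by exfalso; apply: nt; rewrite clock0.
have [nt'|/negP/IH//] := boolP (clock n w <= t).
by exists n; rewrite nt' ltNge; apply/negP.
Qed.

Lemma pdmpE k t x w : clock k w <= t < clock k.+1 w ->
  path_at t x w = flow (state x k w) (t - clock k w).
Proof.
move=> hk; rewrite /pdmp (jump_countE hk) flowE// subr_ge0.
by case/andP: hk.
Qed.

Lemma pdmp_explosion t x w : 0 <= t -> (forall k, clock k w <= t) -> path_at t x w = flow x t.
Proof.
move=> t0 h; rewrite /pdmp (jump_count_explosion h) /= -/(clock 0 w) clock0 subr0.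
by rewrite flowE.
Qed.

Let measurable_clock_le k t : measurable [set w | clock k w <= t].
Proof.
rewrite -[X in measurable X]setTI.
have mk : measurable_fun [set: Omega] (clock k) by exact: measurable_clock_joint.
by have := mk measurableT _ (measurable_itv `]-oo, t]); rewrite set_itvNyc.
Qed.

Lemma measurable_pdmp t : 0 <= t ->
  measurable_fun [set: borel S * Omega] (fun z : borel S * Omega => path_at t z.1 z.2 : borel S).
Proof.
move=> t0 _ A mA; rewrite setTI.
pose B k := [set z : borel S * Omega | clock k z.2 <= t] `&`
  ~` [set z : borel S * Omega | clock k.+1 z.2 <= t] `&`
  [set z : borel S * Omega | A (flow (state z.1 k z.2) (t - clock k z.2))].
pose C := (\bigcap_k [set z : borel S * Omega | clock k z.2 <= t]) `&`
  [set z : borel S * Omega | A (flow z.1 t)].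
have mc k : measurable [set z : borel S * Omega | clock k z.2 <= t].
  rewrite (_ : [set _ | _] = setT `*` [set w | clock k w <= t]).
    exact: measurableX.
  by apply/seteqP; split=> z //= [].
have mflow := measurable_flow Phi_flow polish_S.
have mB k : measurable (B k).
  apply: measurableI; first by apply: measurableI => //; exact: measurableC.
  have m2 : measurable_fun [set: borel S * Omega] (fun z : borel S * Omega => z.2).
    exact: measurable_snd.
  have mt : measurable_fun [set: borel S * Omega] (fun z : borel S * Omega => t - clock k z.2).
    apply: measurable_funB => //.
    have mk : measurable_fun [set: Omega] (clock k) by exact: measurable_clock_joint.
    exact: (measurableT_comp mk m2).
  have mZ : measurable_fun [set: borel S * Omega]
      (fun z : borel S * Omega => state z.1 k z.2 : borel S).
    exact: (measurable_state_joint polish_S Phi_flow mF noise).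
  rewrite -[X in measurable X]setTI.
  exact: (measurableT_comp mflow (measurable_fun_pair mZ mt)).
have mC : measurable C.
  apply: measurableI; first exact: bigcapT_measurable.
  rewrite -[X in measurable X]setTI.
  have m1 : measurable_fun [set: borel S * Omega] (fun z : borel S * Omega => z.1).
    exact: measurable_fst.
  exact: (measurableT_comp (measurable_flow_at polish_S Phi_flow t) m1).
rewrite (_ : _ @^-1` A = \bigcup_k B k `|` C).
  by apply: measurableU => //; exact: bigcupT_measurable.
apply/seteqP; split=> [[x w] /= Aw|[x w] [[k _ [[/= k1 /negP k2] Aw]]|[h Aw]]].
- have [[k hk]|h] := jump_cases w t0.
    left; exists k => //; have /andP[k1 k2] := hk; split; last by rewrite /= -pdmpE.
    by split=> //=; apply/negP; rewrite -ltNge.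
  by right; split; [move=> k _; exact: h|rewrite /= -(pdmp_explosion x t0 h)].
- by rewrite /= (pdmpE (k := k))//; rewrite k1 ltNge.
- by rewrite /= (pdmp_explosion x t0)// => k; exact: h.
Qed.

Local Open Scope ereal_scope.

Let J k t w : R := ((0 <= t - clock k w) && (t - clock k w < E k w))%R%:R.

Lemma jump_indicatorE k t w : J k t w = (clock k w <= t < clock k.+1 w)%R%:R.
Proof. by rewrite /J subr_ge0 clockS ltrBlDl. Qed.

(** Averaging out the waiting time in progress turns its survival indicator
    into the survival function. *)
Lemma piece_jump_indicator x k t h : ui h ->
  piece x k t h = \int[P]_w ((J k t w)%:E * h (flow (state x k w) (t - clock k w))).
Proof.
move=> uh; have [mh h0 h1 hi] := uh.
pose T2 := (borel S * R)%type.
pose a (z : T2) : R := (t - z.2)%R.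
pose f (z : T2 * R) : \bar R :=
  ((0 <= a z.1)%R%:R * (1 - (0 <= a z.1 - z.2)%R%:R))%:E * h (flow z.1.1 (a z.1)).
have bE (b e : R) : ((0 <= b)%R%:R * (1 - (0 <= b - e)%R%:R))%R =
    ((0 <= b) && (b < e))%R%:R :> R.
  by rewrite subr_ge0; case: leP => _; case: ltP => _ /=;
    rewrite ?mul0r ?mul1r ?subr0 ?subrr.
have ma : measurable_fun [set: T2] a by apply: measurable_funB => //; exact: measurable_snd.
have ma1 : measurable_fun [set: T2 * R] (fun z : T2 * R => a z.1).
  exact: (measurableT_comp ma measurable_fst).
have mae : measurable_fun [set: T2 * R] (fun z : T2 * R => a z.1 - z.2)%R.
  by apply: measurable_funB => //; exact: measurable_snd.
have mflow := measurable_flow Phi_flow polish_S.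
have m11 : measurable_fun [set: T2 * R] (fun z : T2 * R => z.1.1).
  exact: (measurableT_comp measurable_fst measurable_fst).
have mf : measurable_fun [set: T2 * R] f.
  apply: emeasurable_funM.
    apply/measurable_EFinP; apply: measurable_funM.
      exact: (measurableT_comp (@measurable_ge0 R) ma1).
    apply: measurable_funB => //.
    exact: (measurableT_comp (@measurable_ge0 R) mae).
  exact: (measurableT_comp mh (measurableT_comp mflow (measurable_fun_pair m11 ma1))).
have f0 z : 0 <= f z by rewrite /f bE mule_ge0// lee_fin.
transitivity (\int[P]_w f ((state x k w : borel S, clock k w), E k w)); last first.
  by apply: eq_integral => w _; rewrite /f bE.
rewrite (integral_next_wait noise (T1 := T2) (D := past k) (n := k)
  (Y := fun w => (state x k w : borel S, clock k w)) (f := f))//; last 2 first.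
- by rewrite /past /= ltnn.
- apply: measurable_fun_pair; last exact: measurable_clock.
  exact: (measurable_state_at polish_S Phi_flow mF noise).
apply: eq_integral => w _; rewrite /f /a /=.
set b := (t - clock k w)%R; set H := h _.
rewrite ge0_integralZr//; last 3 first.
- apply/measurable_EFinP; apply: measurable_funM => //; apply: measurable_funB => //.
  have mB : measurable_fun [set: R] (fun e : R => b - e)%R by exact: measurable_funB.
  exact: (measurableT_comp (@measurable_ge0 R) mB).
- by move=> e _; rewrite bE lee_fin.
- exact: h0.
congr (_ * _); under eq_integral do rewrite bE.
have [b0|b0] := leP 0%R b; last by rewrite surv_lt0//= integral0_eq.
rewrite -(exponential_gt lambda_gt0 (wait_lawE noise) b0).
symmetry; transitivity (\int[nu]_e (\1_[set e | b < e]%R e)%:E).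
  by apply: eq_integral => e _; rewrite indicE mem_setE.
by rewrite integral_indic ?setIT//; rewrite -set_itvoy; exact: measurable_itv.
Qed.

Let measurable_piece_indicator x k t h : ui h -> measurable_fun [set: Omega]
  (fun w => (J k t w)%:E * h (flow (state x k w) (t - clock k w))).
Proof.
move=> [mh _ _ _].
have mk : measurable_fun [set: Omega] (clock k) by exact: measurable_clock_joint.
have mtk : measurable_fun [set: Omega] (fun w => t - clock k w)%R by exact: measurable_funB.
have mZ : measurable_fun [set: Omega] (state x k : Omega -> borel S).
  apply: (info_measurable (E := E) (xi := xi) (D := past k)).
  exact: (measurable_state_at polish_S Phi_flow mF noise).
have mflow := measurable_flow Phi_flow polish_S.
apply: emeasurable_funM; last first.
  exact: (measurableT_comp mh (measurableT_comp mflow (measurable_fun_pair mZ mtk))).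
apply/measurable_EFinP.
rewrite (_ : J k t = \1_([set w | clock k w <= t]%R `\` [set w | clock k.+1 w <= t]%R)).
  by apply: measurable_indic; exact: measurableD.
apply/funext => w; rewrite jump_indicatorE indicE; congr (nat_of_bool _)%:R.
apply/idP/idP => [/andP[w1 w2]|/set_mem[/= w1 w2]].
  by apply/mem_set; split => //=; apply/negP; rewrite -ltNge.
by rewrite w1 /= ltNge; apply/negP.
Qed.

(** A path has exactly one number of jumps at time [t], unless it explodes, when
    both sides vanish. *)
Let sum_indicator x n t h w : (0 <= t)%R -> ui h ->
  \sum_(k < n) ((J k t w)%:E * h (flow (state x k w) (t - clock k w))) =
  if (t < clock n w)%R then h (path_at t x w) else 0.
Proof.
move=> t0 [_ h0 _ _]; have [[k hk]|hw] := jump_cases w t0.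
  have JE m : J m t w = (m == k)%:R.
    rewrite jump_indicatorE; have [->|mk] := eqVneq m k; first by rewrite hk.
    by case: (boolP (_ && _)) => // /(clock_lt_inj hk)/esym/eqP; rewrite (negbTE mk).
  rewrite (pdmpE x hk); have /andP[k1 k2] := hk; have [kn|nk] := ltnP k n.
    rewrite (lt_le_trans k2 (clock_le noise w kn)) (bigD1 (Ordinal kn))//=.
    rewrite JE eqxx mul1e big1 ?adde0// => m mk.
    by rewrite JE (_ : (_ == _) = false) ?mul0e//; exact/negbTE.
  rewrite ltNge (le_trans (clock_le noise w nk) k1)/= big1// => m _.
  by rewrite JE (_ : (_ == _) = false) ?mul0e// ltn_eqF// (leq_trans (ltn_ord m)).
rewrite ltNge hw /= big1// => m _.
by rewrite jump_indicatorE ltNge (hw m.+1) andbF mul0e.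
Qed.

Let measurable_path_at x t h : (0 <= t)%R -> ui h ->
  measurable_fun [set: Omega] (fun w => h (path_at t x w)).
Proof.
move=> t0 [mh _ _ _].
have m : measurable_fun [set: Omega] (fun w : Omega => (x : borel S, w)).
  exact: measurable_fun_pair.
exact: (measurableT_comp mh (measurableT_comp (measurable_pdmp t0) m)).
Qed.

Let sum_piecesE x n t h : (0 <= t)%R -> ui h ->
  \sum_(k < n) piece x k t h =
  \int[P]_w (if (t < clock n w)%R then h (path_at t x w) else 0).
Proof.
move=> t0 uh; have [_ h0 _ _] := uh.
under eq_bigr do rewrite (piece_jump_indicator _ _ _ uh).
rewrite -ge0_integral_sum//; last 2 first.
- by move=> k; exact: measurable_piece_indicator.
- by move=> k w _; rewrite mule_ge0// lee_fin.
by apply: eq_integral => w _; rewrite sum_indicator.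
Qed.

Let measurable_stopped x n t h : (0 <= t)%R -> ui h -> measurable_fun [set: Omega]
  (fun w => if (t < clock n w)%R then h (path_at t x w) else 0).
Proof.
move=> t0 uh.
rewrite (_ : (fun _ => _) = fun w =>
    \sum_(k < n) ((J k t w)%:E * h (flow (state x k w) (t - clock k w)))).
  by apply: emeasurable_sum => k; exact: measurable_piece_indicator.
by apply/funext => w; rewrite sum_indicator.
Qed.

Lemma sum_pieces_le x n t h : (0 <= t)%R -> ui h ->
  \sum_(k < n) piece x k t h <= \int[P]_w h (path_at t x w).
Proof.
move=> t0 uh; have [_ h0 _ _] := uh; rewrite sum_piecesE//.
apply: ge0_le_integral => //.
- by move=> w _; case: ifP.
- exact: measurable_stopped.
- exact: measurable_path_at.
- by move=> w _; case: ifP.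
Qed.

Lemma le_sum_pieces x n t h : (0 <= t)%R -> ui h ->
  \int[P]_w h (path_at t x w) <= \sum_(k < n) piece x k t h + ((1 - surv t) ^+ n)%:E.
Proof.
move=> t0 uh; have [_ h0 h1 _] := uh; rewrite sum_piecesE//.
have mi : measurable_fun [set: Omega] (fun w => (\1_[set w | clock n w <= t]%R w)%:E : \bar R).
  by apply/measurable_EFinP; exact: measurable_indic.
apply: (@le_trans _ _ (\int[P]_w ((if (t < clock n w)%R then h (path_at t x w) else 0) +
    (\1_[set w | clock n w <= t]%R w)%:E))).
  apply: ge0_le_integral => //.
  - exact: measurable_path_at.
  - by apply: emeasurable_funD => //; exact: measurable_stopped.
  - move=> w _; have [tn|nt] := ltP t (clock n w); first by apply: leeDl; rewrite lee_fin.
    by rewrite indicE mem_set// add0e.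
rewrite ge0_integralD//; last 2 first.
- by move=> w _; case: ifP.
- exact: measurable_stopped.
apply: leeD2l; rewrite integral_indic ?setIT//.
exact: (many_jumps_unlikely noise n lambda_gt0 t0).
Qed.

End Process.

(** * Time averages and the evolution of laws *)

Section Evolution.
Context (R : realType) (disp : Order.disp_t) (S : POrderedPointedTopological.type disp).
Context (polish_S : polish R S).
Context (U : ptopologicalType).
Context (Phi : S -> R -> S) (Phi_flow : continuous_semiflow Phi).
Context (lambda : R) (lambda_gt0 : 0 < lambda) (mu : probability (borel U) R).
Context (F : S -> U -> S)
  (mF : measurable_fun [set: borel S * borel U]
          ((fun z => F z.1 z.2) : borel S * borel U -> borel S)).
Context d (Omega : measurableType d) (P : probability Omega R).
Context (E : nat -> {RV P >-> R}) (xi : nat -> {RV P >-> borel U}).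
Context (noise : pdmp_noise E xi lambda mu).
Context (Phi_mono : forall t, 0 <= t -> order_preserving (Phi ^~ t))
  (F_mono : forall u, order_preserving (F ^~ u)).

Local Notation G := (noise_sigma_algebra E xi).
Notation info D := (g_sigma_algebraType (cylinders G D)).
Local Notation flow := (flow Phi).
Local Notation nu := (distribution P (E 0%N)).
Local Notation shock_avg := (shock_avg mu F).
Local Notation ui := (@unit_increasing R disp S).


Local Notation clock := (clock E).
Local Notation state := (state Phi F E xi).
Local Notation surv := (survival lambda).
Local Notation piece := (piece Phi lambda F E xi).
Local Notation total := (total Phi lambda F E xi).
Local Notation path_at t x w := (pdmp Phi F x (E ^~ w) (xi ^~ w) t).


Local Open Scope ereal_scope.
Local Notation Pt := (pdmp_transition E xi Phi F).

Definition time_avg (phi : probability (borel S) R) t (h : S -> \bar R) : \bar R :=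
  \int[phi]_x \int[P]_w h (path_at t x w).

Let measurable_path_avg t h : (0 <= t)%R -> ui h ->
  measurable_fun [set: borel S] (fun x : borel S => \int[P]_w h (path_at t x w)).
Proof.
move=> t0 [mh h0 _ _].
apply: (measurable_fun_fubini_tonelli_F (m2 := P)
  (fun z : borel S * Omega => h (path_at t z.1 z.2))) => [|z]; last exact: h0.
exact: (measurableT_comp mh (measurable_pdmp polish_S Phi_flow mF noise t0)).
Qed.

Let totalE phi n t h : ui h -> total phi n t h = \int[phi]_x \sum_(k < n) piece x k t h.
Proof.
move=> uh; rewrite ge0_integral_sum//.
- by move=> k; exact: (measurable_piece polish_S Phi_flow mF noise).
- by move=> k x _; exact: piece_ge0.
Qed.

Lemma total_le_time_avg phi n t h : (0 <= t)%R -> ui h ->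
  total phi n t h <= time_avg phi t h.
Proof.
move=> t0 uh; rewrite totalE//; apply: ge0_le_integral => //.
- by move=> x _; apply: sume_ge0 => k _; exact: piece_ge0.
- by apply: emeasurable_sum => k; exact: (measurable_piece polish_S Phi_flow mF noise).
- exact: measurable_path_avg.
- by move=> x _; exact: (sum_pieces_le polish_S Phi_flow lambda_gt0 mF noise).
Qed.

Let one_minus_surv t : (0 <= t)%R -> (0 <= 1 - surv t < 1)%R.
Proof.
move=> t0; rewrite subr_ge0 surv_le1 ?ltW//= ltrBlDr ltrDl surv_pos//.
exact: expR_gt0.
Qed.

Lemma time_avg_le_total phi n t h : (0 <= t)%R -> ui h ->
  time_avg phi t h <= total phi n t h + ((1 - surv t) ^+ n)%:E.
Proof.
move=> t0 uh; have [_ h0 _ _] := uh; rewrite totalE//; apply: ge0_integral_leD.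
- by rewrite lee_fin exprn_ge0//; case/andP: (one_minus_surv t0).
- exact: measurable_path_avg.
- by move=> x; exact: integral_ge0.
- by apply: emeasurable_sum => k; exact: (measurable_piece polish_S Phi_flow mF noise).
- by move=> x; apply: sume_ge0 => k _; exact: piece_ge0.
- by move=> x; exact: (le_sum_pieces polish_S Phi_flow lambda_gt0 mF noise).
Qed.

Lemma time_avg_contraction (p : R) (phi psi : probability (borel S) R) : (0 < p < 1)%R ->
  (forall (dl : R) h, (0 <= dl)%R -> ui h -> (forall x y, h x <= h y + dl%:E) ->
    forall x y, shock_avg h x <= shock_avg h y + ((1 - p) * dl)%:E) ->
  forall t h, (0 <= t)%R -> ui h ->
  time_avg phi t h <= time_avg psi t h + (survival (lambda * p) t)%:E.
Proof.
move=> p01 contr t h t0 uh; have [_ h0 h1 _] := uh.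
apply/lee_addgt0Pr => e e0; have [n ne] := exists_expr_le (one_minus_surv t0) e0.
apply: (le_trans (time_avg_le_total phi n t0 uh)); apply: leeD; last by rewrite lee_fin.
have := total_contraction polish_S Phi_flow lambda_gt0 mF noise Phi_mono F_mono phi psi p01 contr n t ler01 uh.
move=> /(_ (fun x y => le_trans (h1 x) (leeDr _ (h0 y)))); rewrite mul1r.
move=> /le_trans; apply; apply: leeD2r; exact: total_le_time_avg.
Qed.

Lemma time_avg_invariant (phi : probability (borel S) R) :
  (forall k, ui k -> \int[phi]_x shock_avg (flow_avg Phi nu k) x = \int[phi]_x k x) ->
  forall t h, (0 <= t)%R -> ui h -> time_avg phi t h = \int[phi]_x h x.
Proof.
move=> inv t h t0 uh; apply/le_anti/andP; split; apply/lee_addgt0Pr => e e0;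
  have [n ne] := exists_expr_le (one_minus_surv t0) e0.
- apply: (le_trans (time_avg_le_total phi n t0 uh)); apply: leeD; last by rewrite lee_fin.
  exact: (total_le_invariant polish_S Phi_flow lambda_gt0 mF noise).
- have tt : (0 <= t <= t)%R by rewrite t0 lexx.
  apply: (le_trans (invariant_le_total polish_S Phi_flow lambda_gt0 mF noise Phi_mono F_mono t0 inv n tt uh)).
  by apply: leeD; [exact: total_le_time_avg|rewrite lee_fin].
Qed.

(** The law of the state at time [t] is the image of [phi \x P] under the path
    map, which is measurable in the initial state and the noise jointly. *)
Lemma evolve_probability (phi : probability (borel S) R) t : (0 <= t)%R ->
  exists m : probability (borel S) R,
    (forall B, measurable B -> evolve Pt phi t B = m B) /\
    (forall h, ui h -> \int[m]_x h x = time_avg phi t h).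
Proof.
move=> t0; pose f (z : borel S * Omega) : borel S := path_at t z.1 z.2.
have mf : measurable_fun [set: borel S * Omega] f.
  exact: (measurable_pdmp polish_S Phi_flow mF noise t0).
have pT : (phi \x P) setT = 1.
  by rewrite -setXTT product_measure1E//= !probability_setT mule1.
pose p : probability (borel S * Omega)%type R :=
  HB.pack (phi \x P) (Measure_isProbability.Build _ _ _ (phi \x P) pT).
pose f' : {mfun (borel S * Omega)%type >-> borel S} :=
  HB.pack f (isMeasurableFun.Build _ _ _ _ _ mf).
exists (distribution p f'); split => [B mB|h [mh h0 _ _]].
  apply: eq_integral => x _ /=; congr (P _).
  by apply/seteqP; split=> w; rewrite /xsection /= ?in_setE.
rewrite ge0_integral_pushforward//.
transitivity (\int[(phi \x P)%E]_z h (f z)); first by [].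
by rewrite fubini_tonelli1//; exact: (measurableT_comp mh mf).
Qed.

End Evolution.

Section SetFunctions.
Import HBNNSimple.

(** The integral is built from simple functions, whose level sets are measurable.
    This lets a probability measure stand in for a set function known to agree
    with it on measurable sets. *)
Lemma eq_set_function_integral d (T : measurableType d) (R : realType)
    (m1 m2 : set T -> \bar R) (f : T -> \bar R) :
  (forall A, measurable A -> m1 A = m2 A) ->
  (\int[m1]_x f x = \int[m2]_x f x)%E.
Proof.
move=> m12.
have sE (h : {nnsfun T >-> R}) : sintegral m1 h = sintegral m2 h.
  by apply: eq_fsbigr => r _; rewrite m12.
rewrite /integral; congr (_ - _)%E; congr ereal_sup;
  by apply/seteqP; split=> _ [h hf <-]; exists h => //; rewrite sE.
Qed.

End SetFunctions.

(** * Global stability *)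

Section TestFunctions.
Context (R : realType) (disp : Order.disp_t) (S : POrderedPointedTopological.type disp).
Local Notation ui := (@unit_increasing R disp S).

(** The indicator of an increasing Borel set is an increasing test function. *)
Lemma unit_increasing_determine (m1 m2 : probability (borel S) R) :
  polish R S -> closed_order S ->
  (forall A : set S, compact A <-> closed A /\ order_bounded A) ->
  (forall h, ui h -> (\int[m1]_x h x = \int[m2]_x h x)%E) ->
  forall B, measurable B -> m1 B = m2 B.
Proof.
move=> pS cS cE h12; apply: (increasing_sets_determine pS cS cE) => A [mA iA].
have indE (m : probability (borel S) R) : m A = (\int[m]_x (\1_A x)%:E)%E.
  by rewrite integral_indic ?setIT.
rewrite !indE; apply: h12; split.
- by apply/measurable_EFinP; exact: measurable_indic.
- by move=> x; rewrite lee_fin.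
- by move=> x; rewrite lee_fin indicE lern1; case: (_ \in _).
- move=> x y xy; rewrite lee_fin !indicE; have [/set_mem Ax|_] := boolP (x \in A).
    by rewrite mem_set//; exact: iA Ax.
  by rewrite ler0n.
Qed.

(** An affine change of scale turns bounded increasing functions with values in
    [[-1, 1]] into test functions with values in [[0, 1]]. *)
Lemma ibS_unit_increasing (h : borel S -> R) : ibS S R h -> (forall x, `|h x| <= 1) ->
  ui (fun x => ((h x + 1) / 2)%:E) /\
  forall m : probability (borel S) R,
    (\int[m]_x (h x)%:E = (2 * fine (\int[m]_x ((h x + 1) / 2)%:E) - 1)%:E)%E.
Proof.
move=> [mh _ hi] h1.
have hb x : -1 <= h x <= 1 by rewrite -ler_norml.
have uk : ui (fun x => ((h x + 1) / 2)%:E).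
  split.
  - apply/measurable_EFinP; apply: measurable_funM => //; exact: measurable_funD.
  - by move=> x; rewrite lee_fin divr_ge0// -lerBlDr sub0r; case/andP: (hb x).
  - by move=> x; rewrite lee_fin ler_pdivrMr// mul1r; have := hb x; lra.
  - by move=> x y /hi xy; rewrite lee_fin ler_pM2r ?invr_gt0// lerD2r.
split => // m; have [mk k0 k1 _] := uk.
have kfin : (\int[m]_x ((h x + 1) / 2)%:E)%E \is a fin_num.
  rewrite ge0_fin_numE; last exact: integral_ge0.
  by apply: le_lt_trans (ltry 1); exact: integral_le1.
have hint : m.-integrable setT (EFin \o h).
  apply: measurable_bounded_integrable => //.
    by rewrite (le_lt_trans (probability_le1 _ _)) ?ltry.
  exists 1; split => // r r1 x _; exact: le_trans (h1 x) (ltW r1).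
have cint : m.-integrable setT (EFin \o cst (1 : R)).
  exact: finite_measure_integrable_cst.
rewrite EFinB EFinM fineK//.
rewrite -ge0_integralZl//.
rewrite [X in (_ = X - _)%E](eq_integral (fun x => (h x)%:E + 1)%E); last first.
  move=> x _; rewrite -EFinM -EFinD; congr _%:E; rewrite mulrC divfK//.
rewrite integralD_EFin//= integral_probability_cst addeK//.
Qed.

End TestFunctions.

Lemma surv_cvg0 (R : realType) (c : R) : 0 < c -> survival c t @[t --> +oo] --> (0 : R).
Proof.
move=> c0; have : expR (- (c * t)) @[t --> +oo] --> (0 : R).
  apply: (@cvg_comp _ _ _ (fun t => c * t) (fun t => expR (- t)) _ +oo) => //.
    exact: gt0_cvgMry.
  exact: cvgr_expR.
apply: cvg_trans; apply: near_eq_cvg; near=> t; rewrite surv_pos//.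
Unshelve. all: by end_near. Qed.

Theorem theorem8p1 (R : realType)
    (disp : Order.disp_t) (S : POrderedPointedTopological.type disp)
    (polish_S : polish R S) (closed_le : closed_order S)
    (compactE : forall A : set S, compact A <-> closed A /\ order_bounded A)
    (U : ptopologicalType) (polish_U : polish R U)
    (Phi : S -> R -> S) (Phi_flow : continuous_semiflow Phi)
    (lambda : R) (lambda_gt0 : 0 < lambda)
    (mu : probability (borel U) R)
    (F : S -> U -> S)
    (mF : measurable_fun [set: borel S * borel U]
            ((fun z => F z.1 z.2) : borel S * borel U -> borel S))
    (d : measure_display) (Omega : measurableType d) (P : probability Omega R)
    (E : nat -> {RV P >-> R}) (xi : nat -> {RV P >-> borel U})
    (noise : pdmp_noise E xi lambda mu)
    (Phi_mono : forall t, 0 <= t -> order_preserving (Phi ^~ t))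
    (F_mono : forall u, order_preserving (F ^~ u))
    (f1 f2 : borel U -> borel S)
    (mf1 : measurable_fun [set: borel U] f1)
    (mf2 : measurable_fun [set: borel U] f2)
    (F_bounds : forall x : S,
       {ae mu, forall u, ((f1 u : S) <= F x u)%O /\ (F x u <= (f2 u : S))%O})
    (mixing : (0 < (mu \x mu)
       [set p : borel U * borel U | ((f2 p.1 : S) <= (f1 p.2 : S))%O])%E) :
  globally_stable (pdmp_transition E xi Phi F).
Proof.
(* A value of [p] strictly below [1] keeps the thinned rate below [lambda]. *)
have [p [p01 pM]] : exists p : R, 0 < p < 1 /\ (p%:E <= (mu \x mu)
    [set q : borel U * borel U | ((f2 q.1 : S) <= (f1 q.2 : S))%O])%E.
  move: mixing; case: ((mu \x mu)%E _) => [r|_|//].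
    rewrite lte_fin => r0; exists (Num.min (r / 2) (1 / 2)).
    rewrite lt_min gt_min lee_fin ge_min; split; last first.
      by apply/orP; left; rewrite ler_pdivrMr// ler_pMr// ler1n.
    by apply/andP; split; [apply/andP; split; lra|apply/orP; right; lra].
  by exists (1 / 2); split; [lra|rewrite leey].
have p0 : 0 <= p by case/andP: p01 => /ltW.
have c0 : 0 < lambda * p by rewrite mulr_gt0//; case/andP: p01.
have contr (dl : R) h (dl0 : 0 <= dl) :=
  shock_avg_contraction polish_S closed_le mF mf1 mf2 F_bounds (h := h) p0 dl0 pM.
have merge (phi psi : probability (borel S) R) :=
  time_avg_contraction polish_S Phi_flow lambda_gt0 mF noise Phi_mono F_mono phi psi p01 contr.
have [|phi inv] := exists_prejump_invariant polish_S closed_le compactE Phi_flow mF noise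
  Phi_mono F_mono mf1 mf2 F_bounds _ pM.
  by case/andP: p01 => -> /ltW ->.
have phi_inv := time_avg_invariant polish_S Phi_flow lambda_gt0 mF noise Phi_mono F_mono inv.
have law psi t (t0 : 0 <= t) := evolve_probability polish_S Phi_flow mF noise psi t0.
have det m1 m2 := @unit_increasing_determine R disp S m1 m2 polish_S closed_le compactE.
have near_phi (psi : probability (borel S) R) t h : 0 <= t -> unit_increasing h ->
    (time_avg Phi F E xi psi t h <= \int[phi]_x h x + (survival (lambda * p) t)%:E /\
     \int[phi]_x h x <= time_avg Phi F E xi psi t h + (survival (lambda * p) t)%:E)%E.
  move=> t0 uh; split.
    by rewrite -(phi_inv _ _ t0 uh); exact: merge.
  by rewrite -{1}(phi_inv _ _ t0 uh); exact: merge.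
have small (e : R) : 0 < e -> exists2 t, 0 <= t & survival (lambda * p) t <= e.
  move=> e0; have := surv_cvg0 c0 => /cvgrPdist_le/(_ e e0) he.
  have [M [_ hM]] := he; exists (Num.max 0 (M + 1)); first by rewrite le_max lexx.
  have := hM (Num.max 0 (M + 1)).
  by rewrite /= lt_max ltrDl ltr01 orbT sub0r normrN ger0_norm ?surv_ge0//; apply.
exists phi; split.
- move=> t t0 B mB; have [m [mE mI]] := law phi t t0; rewrite mE//.
  apply: det => // h uh; rewrite mI//; exact: phi_inv.
- move=> psi stat; apply: det => h uh.
  have psiE t : 0 <= t -> (\int[psi]_x h x = time_avg Phi F E xi psi t h)%E.
    move=> t0; have [m [mE mI]] := law psi t t0; rewrite -mI//.
    apply: eq_measure_integral => A mA _.
    exact: etrans (esym (stat t t0 A mA)) (mE A mA).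
  apply/le_anti/andP; split; apply/lee_addgt0Pr => e /small[t t0 te].
  + rewrite (psiE t t0); have [h1 _] := near_phi psi t h t0 uh.
    by apply: (le_trans h1); apply: leeD2l; rewrite lee_fin.
  + rewrite (psiE t t0); have [_ h2] := near_phi psi t h t0 uh.
    by apply: (le_trans h2); apply: leeD2l; rewrite lee_fin.
- move=> psi.
  have beta0 t : 0 <= t -> (0 <= beta (evolve (pdmp_transition E xi Phi F) psi t) phi)%E.
    move=> t0; have [m [mE mI]] := law psi t t0.
    apply: ereal_sup_ubound; exists (cst 0) => /=.
      split; last by move=> x; rewrite normr0.
      split => //; first by exists 0 => x; rewrite normr0.
    rewrite (eq_set_function_integral (m2 := m))//.
    by rewrite !integral0_eq// subee// abse0.
  apply: (@squeeze_cvge _ _ _ _ (cst 0%E) _ (fun t => (2 * survival (lambda * p) t)%:E)).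
  + near=> t; have t0 : 0 <= t by near: t; exact: nbhs_pinfty_ge.
    rewrite beta0//=.
    apply: ge_ereal_sup => _ [h [hi h1] <-].
    have [uk hE] := ibS_unit_increasing hi h1.
    have [m [mE mI]] := law psi t t0.
    rewrite (eq_set_function_integral (m2 := m))//.
    have [] := near_phi psi t _ t0 uk; rewrite -mI// !hE.
    set k := (fun x => _) in uk *; have [mk k0 k1 _] := uk.
    have kfin (q : probability (borel S) R) : (\int[q]_x k x)%E \is a fin_num.
      rewrite ge0_fin_numE; last exact: integral_ge0.
      by apply: le_lt_trans (ltry 1); exact: integral_le1.
    rewrite -(fineK (kfin m)) -(fineK (kfin phi)) -!EFinD !lee_fin => b1 b2.
    by rewrite ler_norml /=; lra.
  + exact: cvg_cst.
  + rewrite -[X in _ --> X](_ : (2 * 0)%:E = 0%E); last by rewrite mulr0.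
    apply: cvg_EFin; first exact: nearW.
    by apply: cvgMr; exact: surv_cvg0.
Unshelve. all: by end_near. Qed.
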